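(* Let $\mathcal{A}$ be a $W^{*}$-algebra. (a) Let $F,G\in\widehat{\mathcal{M}\Phi}_{l}(l_2(\mathcal{A}))$ have closed images and suppose that $\operatorname{Im}GF$ is closed. Then $\operatorname{Im}F$, $\operatorname{Im}G$, $\operatorname{Im}GF$ are complementable in $l_2(\mathcal{A})$. Moreover, if $\operatorname{Im}F^{0}$, $\operatorname{Im}G^{0}$, $\operatorname{Im}GF^{0}$ denote the complements of $\operatorname{Im}F$, $\operatorname{Im}G$, $\operatorname{Im}GF$, respectively, then $$\operatorname{Im}GF^{0}\preceq \operatorname{Im}F^{0}\oplus\operatorname{Im}G^{0},\qquad \ker GF\preceq\ker G\oplus\ker F.$$ (b) If $F,G\in\widehat{\mathcal{M}\Phi}_{r}(l_2(\mathcal{A}))$ and $\operatorname{Im}F$, $\operatorname{Im}G$, $\operatorname{Im}GF$ are closed and complementable in $l_2(\mathcal{A})$, then, with the same notation, $$\operatorname{Im}GF^{0}\preceq \operatorname{Im}F^{0}\oplus\operatorname{Im}G^{0},\qquad \ker GF\preceq\ker G\oplus\ker F.$$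
   Context: $l_{2}(\mathcal{A})$ is the standard (right) Hilbert $C^{*}$-module over $\mathcal{A}$ of sequences $(a_i)_{i\in\mathbb{N}}$ in $\mathcal{A}$ with $\sum_i a_i^{*}a_i$ norm-convergent. $B(l_2(\mathcal{A}))$ is the set of bounded $\mathcal{A}$-linear (not necessarily adjointable) operators on $l_2(\mathcal{A})$. A Hilbert module is finitely generated if it is the linear span (over $\mathbb{C}$ and $\mathcal{A}$) of a finite subset. $\tilde\oplus$ denotes the direct sum of closed submodules, not necessarily orthogonal. A closed submodule $X$ is complementable if there is a closed submodule $X^{0}$ (a complement) with $X\tilde\oplus X^{0}=l_2(\mathcal{A})$; complements are unique up to isomorphism. Isomorphism means bounded $\mathcal{A}$-linear bijection. $N_1\preceq N_2$ means that $N_1$ is isomorphic to a closed submodule of $N_2$. In the displayed relations $\oplus$ is the (external) direct sum of Hilbert modules. $\widehat{\mathcal{M}\Phi}_{l}(l_2(\mathcal{A}))$ (resp. $\widehat{\mathcal{M}\Phi}_{r}(l_2(\mathcal{A}))$) is the set of $F\in B(l_2(\mathcal{A}))$ for which there are closed submodules with $l_2(\mathcal{A})=M_1\tilde\oplus N_1=M_2\tilde\oplus N_2$, $F(M_1)\subseteq M_2$, $F(N_1)\subseteq N_2$, $F|_{M_1}:M_1\to M_2$ an isomorphism, and $N_1$ (resp. $N_2$) finitely generated. *)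

(* Defs.v *)
From HB Require Import structures.
From mathcomp Require Import all_boot all_order all_algebra.
From mathcomp Require Import complex.
From mathcomp Require Import all_classical all_reals topology normedtype sequences.

Set Implicit Arguments.
Unset Strict Implicit.
Unset Printing Implicit Defensive.

Import Order.TTheory GRing.Theory Num.Theory.

Local Open Scope classical_set_scope.
Local Open Scope complex_scope.
Local Open Scope ring_scope.

(* Unital C*-algebras over R[i]; the zero algebra is allowed.  The product is a
   field of the mixin, not a GRing structure: a Hierarchy-Builder join of
   rings with normed Z-modules would have to be declared before NumDomain. *)
HB.mixin Record isCStarAlgebra (R : realType) A
    & CompleteNormedModule R[i] A := {
  cunit : A ;
  cmul : A -> A -> A ;
  star : A -> A ;
  cmulA : forall a b c : A, cmul a (cmul b c) = cmul (cmul a b) c ;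
  cmul1l : forall a : A, cmul cunit a = a ;
  cmul1r : forall a : A, cmul a cunit = a ;
  cmulDl : forall a b c : A, cmul (a + b) c = cmul a c + cmul b c ;
  cmulDr : forall a b c : A, cmul a (b + c) = cmul a b + cmul a c ;
  cmulZl : forall (k : R[i]) (a b : A), cmul (k *: a) b = k *: cmul a b ;
  cmulZr : forall (k : R[i]) (a b : A), cmul a (k *: b) = k *: cmul a b ;
  starD : forall a b : A, star (a + b) = star a + star b ;
  starZ : forall (k : R[i]) (a : A), star (k *: a) = k^* *: star a ;
  starM : forall a b : A, star (cmul a b) = cmul (star b) (star a) ;
  starK : forall a : A, star (star a) = a ;
  cstar_normM : forall a b : A, `|cmul a b| <= `|a| * `|b| ;
  cstar_norm : forall a : A, `|cmul (star a) a| = `|a| ^+ 2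
}.

#[short(type="cstarAlgType")]
HB.structure Definition CStarAlgebra (R : realType) :=
  { A of isCStarAlgebra R A & CompleteNormedModule R[i] A }.

(* The pairing p identifies A, isometrically and linearly, with the space of
   all bounded linear functionals on E, carrying the operator norm. *)
Definition is_dual_pairing (R : realType) (A : cstarAlgType R)
    (E : completeNormedModType R[i]) (p : A -> E -> R[i]) : Prop :=
  [/\ forall a, scalar (p a),
      forall e, scalar (fun a => p a e),
      forall a e, `|p a e| <= `|a| * `|e|,
      forall a (k : R[i]), 0 <= k ->
        (forall e, `|p a e| <= k * `|e|) -> `|a| <= k
    & forall phi : E -> R[i], scalar phi ->
        (exists k : R[i], forall e, `|phi e| <= k * `|e|) ->
        exists a, forall e, phi e = p a e].

(* Sakai's definition: a C*-algebra that is the dual of a Banach space. *)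
Definition is_wstar (R : realType) (A : cstarAlgType R) : Prop :=
  exists (E : completeNormedModType R[i]) (p : A -> E -> R[i]),
    is_dual_pairing p.

(* The data of a right Hilbert A-module whose elements are the points of the
   set [elts] in the complex vector space [space]; the values of the operations
   and of maps outside [elts] are irrelevant.  The axioms are not bundled: for
   l2 A below, even closure of [elts] under addition is a theorem resting on
   the positivity of cmul (star a) a.  Only l2 A and its sum with itself are used. *)
Record hilbModData (R : realType) (A : cstarAlgType R) := HilbModData {
  space :> lmodType R[i] ;
  ract : space -> A -> space ;
  inner : space -> space -> A ;
  elts : set space
}.

Section HilbertModules.
Context (R : realType) (A : cstarAlgType R).
Implicit Types V W : hilbModData A.

Definition hnorm V (x : V) : R[i] := sqrtC `|inner x x|.

Definition is_submodule V (M : set V) : Prop :=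
  [/\ M `<=` @elts _ _ V,
      M 0,
      forall x y, M x -> M y -> M (x + y),
      forall (c : R[i]) x, M x -> M (c *: x)
    & forall x (a : A), M x -> M (ract x a)].

Definition is_closed V (M : set V) : Prop :=
  forall x, elts x ->
    (forall e : R[i], 0 < e -> exists2 y, M y & hnorm (x - y) < e) -> M x.

Definition closed_submodule V (M : set V) : Prop :=
  is_submodule M /\ is_closed M.

Definition bounded_Alinear V W (M : set V) (N : set W) (f : V -> W) : Prop :=
  [/\ forall x, M x -> N (f x),
      forall x y, M x -> M y -> f (x + y) = f x + f y,
      forall (c : R[i]) x, M x -> f (c *: x) = c *: f x,
      forall x (a : A), M x -> f (ract x a) = ract (f x) a
    & exists k : R[i], forall x, M x -> hnorm (f x) <= k * hnorm x].

Definition is_isomorphism V W (M : set V) (N : set W) (f : V -> W) : Prop :=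
  bounded_Alinear M N f /\ set_bij M N f.

Definition isomorphic V W (M : set V) (N : set W) : Prop :=
  exists f : V -> W, is_isomorphism M N f.

Definition preceq V W (M : set V) (N : set W) : Prop :=
  exists N' : set W, [/\ closed_submodule N', N' `<=` N & isomorphic M N'].

Definition finitely_generated V (M : set V) : Prop :=
  exists (n : nat) (g : 'I_n -> V), (forall i, M (g i)) /\
    forall x, M x -> exists (c : 'I_n -> R[i]) (a : 'I_n -> A),
      x = \sum_(i < n) (c i *: g i + ract (g i) (a i)).

Definition direct_decomposition V (M N : set V) : Prop :=
  [/\ closed_submodule M, closed_submodule N,
      M `&` N = [set 0]
    & forall x, elts x -> exists m n, [/\ M m, N n & x = m + n]].

Definition complementable V (M : set V) : Prop :=
  exists M0 : set V, direct_decomposition M M0.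

(* External direct sum; for submodules M of V and N of W, the module M (+) N is
   the submodule M `*` N of dsum V W. *)
Definition dsum V W : hilbModData A :=
  @HilbModData R A (V * W)%type
    (fun x a => (ract x.1 a, ract x.2 a))
    (fun x y => inner x.1 y.1 + inner x.2 y.2)
    (@elts _ _ V `*` @elts _ _ W).

End HilbertModules.

Definition l2 (R : realType) (A : cstarAlgType R) : hilbModData A :=
  @HilbModData R A (nat -> A)
    (fun x a => fun i => cmul (x i) a)
    (fun x y => limn (series (fun i => cmul (star (x i)) (y i))))
    [set x | cvgn (series (fun i => cmul (star (x i)) (x i)))].

Section Operators.
Context (R : realType) (A : cstarAlgType R).
Implicit Types F : l2 A -> l2 A.

(* Operators are total functions on nat -> A, of which only the restriction to
   the square-summable sequences matters. *)
Definition bounded_operator F : Prop :=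
  bounded_Alinear (@elts _ _ (l2 A)) (@elts _ _ (l2 A)) F.

Definition Im F : set (l2 A) := F @` (@elts _ _ (l2 A)).

Definition Ker F : set (l2 A) := [set x | elts x /\ F x = 0].

Definition MPhi_decomposition F (M1 N1 M2 N2 : set (l2 A)) : Prop :=
  [/\ direct_decomposition M1 N1, direct_decomposition M2 N2,
      F @` M1 `<=` M2, F @` N1 `<=` N2
    & is_isomorphism M1 M2 F].

Definition MPhi_l F : Prop := bounded_operator F /\
  exists M1 N1 M2 N2 : set (l2 A),
    MPhi_decomposition F M1 N1 M2 N2 /\ finitely_generated N1.

Definition MPhi_r F : Prop := bounded_operator F /\
  exists M1 N1 M2 N2 : set (l2 A),
    MPhi_decomposition F M1 N1 M2 N2 /\ finitely_generated N2.

(* M `*` N, read as a subset of the external direct sum l2 A (+) l2 A *)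
Definition ext_sum (M N : set (l2 A)) : set (dsum (l2 A) (l2 A)) := M `*` N.

End Operators.

(* Main.v *)
(* Let [N] be a closed submodule of l2(A) generated by [h_1, ..., h_n].  By the
   open mapping theorem the frame operator [B y = \sum_i h_i <h_i, y>] is bounded
   below on [N], hence invertible there, and [w_i = B^-1 h_i] satisfies
   [y = \sum_i h_i <w_i, y>] on [N].  So [N] is the range of a bounded projection
   and every bounded surjection onto [N] splits.

   If [F] maps [M1 (+) N1] diagonally to [M2 (+) N2], then [F(N1) = Im F /\ N2] is
   closed and finitely generated: in (a) because [N1] is, in (b) because it is the
   image of [N2] under a projection.  Splitting [N1 -> F(N1)] gives a bounded [S]
   with [F S F = F].  In (a), the same argument applied to the image of [Ker G]
   under [1 - F S] produces such an inverse for [G F], so the images are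
   complementable.

   With [S] and [T] such inverses of [F] and [G], the map [x |-> (F x, x - S F x)]
   embeds [Ker GF] in [Ker G (+) Ker F] with left inverse [(a, b) |-> S a + b].
   Writing [P_F], [P_G], [P_GF] for the projections onto the given complements of
   the images, [x |-> (P_F T (x - P_G x), P_G x)] embeds the complement of [Im GF]
   with left inverse [(a, b) |-> P_GF (G a + b)]. *)

Require Import Defs.
From mathcomp Require Import all_boot all_order all_algebra.
From mathcomp Require Import complex ring lra.
From mathcomp Require Import all_classical all_reals topology normedtype sequences.
Set Implicit Arguments.
Unset Strict Implicit.
Unset Printing Implicit Defensive.
Import Order.TTheory GRing.Theory Num.Theory.
Import numFieldNormedType.Exports.
Import Defs.
Local Open Scope classical_set_scope.
Local Open Scope complex_scope.
Local Open Scope ring_scope.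

(** Operators here need not have adjoints and closed submodules need not have orthogonal
    complements, so no splitting comes for free. Each one is manufactured from finitely many
    functionals [y |-> <w, y>], which are bounded and A-linear on all of l2(A); this is why vectors
    [w_i] that reproduce [y] on [N] alone already give an operator defined everywhere. That the
    frame operator is bounded below has to be understood in the order of A, as [<y, y> <= K \sum_i
    star <h_i, y> ** <h_i, y>]: the contraction estimate for [1 - B / s] adds A-valued inequalities
    before any norm is taken. The open mapping theorem yields only norm bounds on coefficients; the
    passage to the order comes from normalising [y] by an inverse square root of [<y, y> + e]. The
    order is built from the norm alone. Square roots and inverses are fixed points of contractions,
    always taken after a shift by some [e > 0], and the shift is removed at the end because the
    positive elements form a closed set. *)

Inductive lexp (K : Type) :=
| LVar of nat | LZero | LAdd of lexp K & lexp K | LOpp of lexp K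
| LScale of K & lexp K.
Arguments LVar {K}.
Arguments LZero {K}.

(** * Linear identities in a module, by reflection *)

Section LinearExpressions.
Context (K : comPzRingType) (V : lmodType K).

Fixpoint leval (env : seq V) (e : lexp K) : V :=
  match e with
  | LVar i => nth 0 env i
  | LZero => 0
  | LAdd e1 e2 => leval env e1 + leval env e2
  | LOpp e1 => - leval env e1
  | LScale k e1 => k *: leval env e1
  end.

Fixpoint lcoef (e : lexp K) (i : nat) : K :=
  match e with
  | LVar j => if eqn i j then 1 else 0
  | LZero => 0
  | LAdd e1 e2 => lcoef e1 i + lcoef e2 i
  | LOpp e1 => - lcoef e1 i
  | LScale k e1 => k * lcoef e1 i
  end.

Lemma leval_sum env e : leval env e = \sum_(i < size env) lcoef e i *: env`_i.
Proof.
elim: e => [j||e1 IH1 e2 IH2|e1 IH|k e1 IH] /=; rewrite ?IH1 ?IH2 ?IH.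
- have [lt_j|le_j] := ltnP j (size env); last first.
    rewrite nth_default// big1// => i _; rewrite -[eqn _ _]/(val i == j).
    by rewrite ltn_eqF ?scale0r// (leq_trans (ltn_ord i)).
  rewrite (bigD1 (Ordinal lt_j))//= -[eqn _ _]/(j == j) eqxx scale1r.
  rewrite big1 ?addr0// => i ij; rewrite -[eqn _ _]/(i == Ordinal lt_j).
  by rewrite (negPf ij) scale0r.
- by rewrite big1// => i _; rewrite scale0r.
- by rewrite -big_split; apply: eq_bigr => i _; rewrite scalerDl.
- by rewrite -sumrN; apply: eq_bigr => i _; rewrite scaleNr.
- by rewrite scaler_sumr; apply: eq_bigr => i _; rewrite scalerA.
Qed.

(** A recursive conjunction rather than a bounded quantifier, so that [/=] turns it into one
    coefficient equation per atom. *)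
Fixpoint all_lt (P : nat -> Prop) (n : nat) : Prop :=
  if n is m.+1 then P m /\ all_lt P m else True.

Lemma lin_eq env e1 e2 : all_lt (fun i => lcoef e1 i = lcoef e2 i) (size env) ->
  leval env e1 = leval env e2.
Proof.
rewrite !leval_sum => h; apply: eq_bigr => -[i lt_i] _; congr (_ *: _) => /=.
elim: (size env) h lt_i => [//|n IH] /= [hn h]; rewrite ltnS leq_eqVlt.
by case/predU1P => [->//|]; apply: IH.
Qed.
End LinearExpressions.

Ltac lin_index a l :=
  match l with
  | a :: _ => constr:(0%N)
  | _ :: ?l' => let n := lin_index a l' in constr:(S n)
  end.
Ltac lin_insert a l :=
  match l with
  | nil => constr:(a :: nil)
  | a :: _ => constr:(l)
  | ?b :: ?l' => let l2 := lin_insert a l' in constr:(b :: l2)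
  end.
Ltac lin_atoms t l :=
  match t with
  | GRing.add ?x ?y => let l1 := lin_atoms x l in lin_atoms y l1
  | GRing.opp ?x => lin_atoms x l
  | GRing.scale _ ?x => lin_atoms x l
  | GRing.zero => constr:(l)
  | _ => lin_insert t l
  end.
Ltac lin_reify K t l :=
  match t with
  | GRing.add ?x ?y =>
    let e1 := lin_reify K x l in let e2 := lin_reify K y l in
    constr:(@LAdd K e1 e2)
  | GRing.opp ?x => let e := lin_reify K x l in constr:(@LOpp K e)
  | GRing.scale ?k ?x => let e := lin_reify K x l in constr:(@LScale K k e)
  | GRing.zero => constr:(@LZero K)
  | _ => let n := lin_index t l in constr:(@LVar K n)
  end.
(* Reduces an equation between K-linear combinations to one equation in K per atom. *)
Ltac lmodule K :=
  match goal with
  | |- @eq ?T ?t1 ?t2 =>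
    let l0 := constr:(@nil T) in
    let l1 := lin_atoms t1 l0 in
    let l := lin_atoms t2 l1 in
    let e1 := lin_reify K t1 l in
    let e2 := lin_reify K t2 l in
    apply: (@lin_eq _ _ l e1 e2);
    rewrite /=; repeat split
  end.

(** * Banach spaces carried by subsets of a module *)

Section BanachSets.
Context (R : realType) (V : lmodType R[i]).
Implicit Types (E D : set V) (nm : V -> R) (u : nat -> V).

Definition tends nm u (l : V) : Prop :=
  forall e : R, 0 < e -> exists N, forall n, (N <= n)%N -> nm (u n - l) <= e.

Definition nclosed E nm D : Prop :=
  forall x, E x -> (forall e : R, 0 < e -> exists2 y, D y & nm (x - y) <= e) -> D x.

(** The norm axioms are relative to the carrier [E], because the l2 norm means nothing on arbitrary
    sequences. Homogeneity is recorded for real scalars, the ones by which the series arguments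
    rescale. *)
Record banach E nm : Prop := Banach {
  banach0 : E 0 ;
  banachD : forall x y, E x -> E y -> E (x + y) ;
  banachZ : forall (c : R[i]) x, E x -> E (c *: x) ;
  nm_ge0 : forall x, 0 <= nm x ;
  nmD : forall x y, E x -> E y -> nm (x + y) <= nm x + nm y ;
  nmZ : forall (r : R) x, E x -> nm (r%:C *: x) = `|r| * nm x ;
  nm_eq0 : forall x, E x -> nm x = 0 -> x = 0 ;
  banach_complete : forall u, (forall n, E (u n)) ->
    (forall e : R, 0 < e -> exists N, forall m n, (N <= m)%N -> (N <= n)%N ->
       nm (u m - u n) <= e) ->
    exists2 l, E l & tends nm u l }.

Lemma geometric_small (r c e : R) : 0 <= r < 1 -> 0 < e ->
  exists N, forall n, (N <= n)%N -> c * r ^+ n <= e.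
Proof.
move=> /andP[r0 r1] e0.
have /cvgrPdist_le hr : r ^+ n @[n --> \oo] --> (0 : R).
  by apply: cvg_expr; rewrite ger0_norm.
have d0 : 0 < e / (`|c| + 1) by rewrite divr_gt0// ltr_wpDl.
have [N _ hN] := hr _ d0; exists N => n /hN /=.
rewrite sub0r normrN ger0_norm ?exprn_ge0// ler_pdivlMr ?ltr_wpDl// => h.
apply: le_trans h; rewrite mulrC ler_wpM2l ?exprn_ge0//.
by rewrite (le_trans (ler_norm _))// lerDl.
Qed.

Section Theory.
Context (E : set V) (nm : V -> R) (hE : banach E nm).

Lemma banachN x : E x -> E (- x).
Proof. by move=> ?; rewrite -scaleN1r; apply: banachZ hE _ _ _. Qed.

Lemma banachB x y : E x -> E y -> E (x - y).
Proof. by move=> ? /banachN; apply: banachD hE _ _ _. Qed.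

Lemma nmN x : E x -> nm (- x) = nm x.
Proof.
move=> Ex; have := nmZ hE (-1) Ex.
by rewrite rmorphN rmorph1 scaleN1r normrN normr1 mul1r.
Qed.

Lemma nm0 : nm 0 = 0.
Proof.
by have := nmZ hE 0 (banach0 hE); rewrite scaler0 normr0 mul0r.
Qed.

Lemma nm_distC x y : E x -> E y -> nm (x - y) = nm (y - x).
Proof. by move=> Ex Ey; rewrite -nmN ?opprB//; apply: banachB. Qed.

Lemma nm_triangle x y z : E x -> E y -> E z ->
  nm (x - z) <= nm (x - y) + nm (y - z).
Proof.
move=> Ex Ey Ez; rewrite -[x - z](subrKA y).
by apply: nmD hE _ _ _ _; apply: banachB.
Qed.

Lemma eq_small x y : E x -> E y ->
  (forall e : R, 0 < e -> nm (x - y) <= e) -> x = y.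
Proof.
move=> Ex Ey h; apply/subr0_eq/(nm_eq0 hE (banachB Ex Ey)).
by apply/eqP; rewrite eq_le (nm_ge0 hE) andbT; apply/ler_addgt0Pl => e /h; rewrite addr0.
Qed.

Lemma tends_closed D u l : nclosed E nm D -> (forall n, E (u n)) ->
  (forall n, D (u n)) -> E l -> tends nm u l -> D l.
Proof.
move=> clD Eu Du El ul; apply: clD => // e /ul[N /(_ N (leqnn N)) h].
by exists (u N) => //; rewrite nm_distC.
Qed.

Lemma geometric_cvg u (c r : R) : 0 <= r < 1 -> (forall n, E (u n)) ->
  (forall n, nm (u n.+1 - u n) <= c * r ^+ n) ->
  exists2 l, E l & tends nm u l /\
    forall n, nm (u n - l) <= c / (1 - r) * r ^+ n.
Proof.
move=> r01 Eu hu; have /andP[r0 r1] := r01.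
have r1' : 0 < 1 - r by rewrite subr_gt0.
(* Keeping the term [- r ^+ (n + k)] lets the induction close with an exact identity; it is dropped
   in [bnd]. *)
have step n k : nm (u (n + k)%N - u n) <= c / (1 - r) * (r ^+ n - r ^+ (n + k)).
  elim: k => [|k IH]; first by rewrite addn0 !subrr nm0 mulr0.
  rewrite addnS (le_trans (nm_triangle _ (Eu (n + k)%N) _))//.
  rewrite (le_trans (lerD (hu _) IH))// exprS le_eqVlt; apply/orP; left.
  by apply/eqP; field; rewrite gt_eqF.
have c0 : 0 <= c by have := le_trans (nm_ge0 hE _) (hu 0%N); rewrite mulr1.
have c1 : 0 <= c / (1 - r) by rewrite divr_ge0// ltW.
have bnd n m : (n <= m)%N -> nm (u m - u n) <= c / (1 - r) * r ^+ n.
  move=> nm'; rewrite -(subnKC nm') (le_trans (step _ _))// ler_wpM2l//.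
  by rewrite gerBl exprn_ge0.
have [||l El ul] := banach_complete hE (u := u) => //.
  move=> e e0; have [N hN] := geometric_small (c / (1 - r)) r01 e0.
  exists N => m n Nm Nn; have [mn|/ltnW mn] := leqP m n.
    by rewrite nm_distC// (le_trans (bnd _ _ mn))// hN.
  by rewrite (le_trans (bnd _ _ mn))// hN.
exists l => //; split=> // n; apply/ler_addgt0Pl => e /ul[N hN].
rewrite (le_trans (nm_triangle _ (Eu (maxn n N)) _))// addrC lerD//.
  by rewrite hN// leq_maxr.
by rewrite nm_distC// bnd// leq_maxl.
Qed.

(** Iterating inside a closed subset [D] lets the fixed point inherit whatever closed conditions
    define [D]: self-adjointness, a norm bound, membership in a commutant. *)
Lemma contraction D (f : V -> V) (r : R) x0 : D `<=` E -> nclosed E nm D ->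
  D x0 -> (forall x, D x -> D (f x)) -> 0 <= r < 1 ->
  (forall x y, D x -> D y -> nm (f x - f y) <= r * nm (x - y)) ->
  exists2 x, D x & f x = x.
Proof.
move=> DE clD Dx0 fD r01 hf; pose u n := iter n f x0.
have /andP[r0 _] := r01.
have Du n : D (u n) by elim: n => //= n; apply: fD.
have Eu n : E (u n) by apply: DE.
have hu n : nm (u n.+1 - u n) <= nm (u 1%N - u 0%N) * r ^+ n.
  elim: n => [|n IH]; first by rewrite mulr1.
  apply: le_trans (hf _ _ (Du n.+1) (Du n)) _; rewrite exprS mulrCA.
  by rewrite ler_wpM2l.
have [l El [ul _]] := geometric_cvg r01 Eu hu.
have Dl : D l by apply: tends_closed ul.
exists l => //; apply: eq_small => //; first exact/DE/fD.
move=> e e0; have e2 : 0 < e / 2 by rewrite divr_gt0.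
have [N hN] := ul _ e2.
rewrite (splitr e) (le_trans (nm_triangle _ (Eu N.+1) _))//; first exact/DE/fD.
rewrite lerD ?hN//; apply: le_trans (hf _ _ Dl (Du N)) _.
rewrite (le_trans (ler_wpM2r (nm_ge0 hE _) (ltW (andP r01).2)))// mul1r.
by rewrite nm_distC// hN.
Qed.

Lemma banach_sub D : D 0 -> (forall x y, D x -> D y -> D (x + y)) ->
  (forall (c : R[i]) x, D x -> D (c *: x)) -> D `<=` E -> nclosed E nm D ->
  banach D nm.
Proof.
move=> D0 DD DZ DE clD; split=> //.
- exact: nm_ge0 hE.
- by move=> x y /DE ? /DE ?; apply: nmD hE _ _ _ _.
- by move=> r x /DE ?; apply: nmZ hE _ _ _.
- by move=> x /DE ?; apply: nm_eq0 hE _ _.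
- move=> u Du hu; have Eu n : E (u n) by apply: DE.
  have [l El ul] := banach_complete hE Eu hu.
  by exists l => //; apply: tends_closed ul.
Qed.

End Theory.
End BanachSets.

(** * C*-algebras: norm and positivity *)

Notation "a ** b" := (cmul a b) (at level 40, left associativity) : ring_scope.

Section Conjugates.
Context (R : realType).

Lemma conjcN1 : conjc (-1) = -1 :> R[i].
Proof. by apply/eqP; rewrite eq_complex /= !oppr0 !eqxx. Qed.

Lemma conjci : conjc 'i%C = - 'i%C :> R[i].
Proof. by apply/eqP; rewrite eq_complex /= !oppr0 !eqxx. Qed.

Lemma conjcNi : conjc (- 'i%C) = 'i%C :> R[i].
Proof. by apply/eqP; rewrite eq_complex /= !oppr0 opprK !eqxx. Qed.

End Conjugates.

Section CStarNorm.
Context (R : realType) (A : cstarAlgType R).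
Implicit Types (a b c d x y : A) (r s t : R).

Lemma cmul0l a : 0 ** a = 0.
Proof. by rewrite -[X in X ** _](scale0r (0 : A)) cmulZl scale0r. Qed.

Lemma cmul0r a : a ** 0 = 0.
Proof. by rewrite -[X in _ ** X](scale0r (0 : A)) cmulZr scale0r. Qed.

Lemma cmulNl a b : (- a) ** b = - (a ** b).
Proof. by rewrite -scaleN1r cmulZl scaleN1r. Qed.

Lemma cmulNr a b : a ** (- b) = - (a ** b).
Proof. by rewrite -scaleN1r cmulZr scaleN1r. Qed.

Lemma cmulBl a b c : (a - b) ** c = a ** c - b ** c.
Proof. by rewrite cmulDl cmulNl. Qed.

Lemma cmulBr a b c : a ** (b - c) = a ** b - a ** c.
Proof. by rewrite cmulDr cmulNr. Qed.

Lemma starZc (k : R[i]) a : star (k *: a) = conjc k *: star a.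
Proof. exact: starZ. Qed.

Lemma starZr r a : star (r%:C *: a) = r%:C *: star a.
Proof. by rewrite starZc conjc_real. Qed.

Lemma star0 : star (0 : A) = 0.
Proof. by rewrite -[X in star X](scale0r (0 : A)) starZc conjc0 scale0r. Qed.

Lemma starN a : star (- a) = - star a.
Proof. by rewrite -scaleN1r -[-1](rmorphN1 (real_complex R)) starZr rmorphN1 scaleN1r. Qed.

Lemma starB a b : star (a - b) = star a - star b.
Proof. by rewrite starD starN. Qed.

Lemma star1 : star (cunit : A) = cunit.
Proof. by rewrite -[LHS]cmul1r -[X in _ ** X]starK -starM cmul1r starK. Qed.

(** The norm of a module over [R[i]] takes values in [R[i]]; this is the same number in [R], where
    real arithmetic applies. *)
Definition nrm a : R := complex.Re `|a|.

Lemma nrmE a : `|a| = (nrm a)%:C.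
Proof. by rewrite /nrm RRe_real// ger0_real. Qed.

Lemma nrm_ge0 a : 0 <= nrm a.
Proof. by rewrite -ler0c -nrmE. Qed.

Lemma nrmD a b : nrm (a + b) <= nrm a + nrm b.
Proof. by rewrite -lecR rmorphD /= -!nrmE ler_normD. Qed.

Lemma nrmZr r a : nrm (r%:C *: a) = `|r| * nrm a.
Proof.
by apply: complexI; rewrite rmorphM /= -!nrmE normrZ normc_def /= expr0n addr0 sqrtr_sqr.
Qed.

Lemma nrm_i a : nrm ('i%C *: a) = nrm a.
Proof.
apply: complexI; rewrite -!nrmE normrZ normc_def /=.
by rewrite expr0n expr1n add0r sqrtr1 mul1r.
Qed.

Lemma nrm_eq0 a : nrm a = 0 -> a = 0.
Proof. by move=> a0; apply/eqP; rewrite -normr_eq0 nrmE a0. Qed.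

Lemma banachA : banach setT nrm.
Proof.
split=> //.
- exact: nrm_ge0.
- by move=> x y _ _; apply: nrmD.
- by move=> r x _; apply: nrmZr.
- by move=> x _; apply: nrm_eq0.
move=> u _ hu.
have : cvg (u @ \oo).
  apply/cauchy_cvgP/cauchy_exP => e e0.
  have [h0 eE] : 0 < complex.Re e /\ (complex.Re e)%:C = e.
    have eE : (complex.Re e)%:C = e by rewrite RRe_real// gtr0_real.
    by split=> //; rewrite -ltcR eE.
  have [N hN] := hu _ (divr_gt0 h0 (ltr0Sn _ 1)).
  exists (u N); exists N => // n /= Nn.
  rewrite -ball_normE /ball_ /= nrmE -eE ltcR (le_lt_trans (hN _ _ _ _))//.
  by rewrite ltr_pdivrMr// ltr_pMr// ltr1n.
move=> /cvg_ex[l /cvgrPdist_le ul]; exists l => // e e0.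
have ec0 : 0 < e%:C by rewrite -[0]/(0%:C) ltcR.
have [N _ hN] := ul _ ec0; exists N => n /hN /=.
by rewrite distrC nrmE lecR.
Qed.

Lemma nrmN a : nrm (- a) = nrm a.
Proof. exact: (nmN banachA). Qed.

Lemma nrm0 : nrm 0 = 0.
Proof. exact: (nm0 banachA). Qed.

Lemma nrmB a b : nrm (a - b) <= nrm a + nrm b.
Proof. by rewrite (le_trans (nrmD _ _))// nrmN. Qed.

Lemma nrm_distC a b : nrm (a - b) = nrm (b - a).
Proof. exact: (nm_distC banachA). Qed.

Lemma nrmM a b : nrm (a ** b) <= nrm a * nrm b.
Proof. by rewrite -lecR rmorphM /= -!nrmE cstar_normM. Qed.

Lemma nrm_sq a : nrm (star a ** a) = nrm a ^+ 2.
Proof. by apply: complexI; rewrite rmorphXn /= -!nrmE cstar_norm. Qed.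

Lemma nrm_star a : nrm (star a) = nrm a.
Proof.
have le_star b : nrm b <= nrm (star b).
  have [->|b0] := eqVneq (nrm b) 0; first exact: nrm_ge0.
  have := nrmM (star b) b; rewrite nrm_sq expr2 ler_pM2r//.
  by rewrite lt_neqAle eq_sym b0 nrm_ge0.
by apply/eqP; rewrite eq_le le_star -{2}(starK a) le_star.
Qed.

(** Only an inequality, since the unit of the zero algebra has norm 0. *)
Lemma nrm1 : nrm (cunit : A) <= 1.
Proof.
have := nrm_sq cunit; rewrite star1 cmul1l expr2 => h.
have [->//|n0] := eqVneq (nrm (cunit : A)) 0.
by rewrite -(mulfI n0 (etrans (mulr1 _) h)).
Qed.

Lemma nrm_scalar r : 0 <= r -> nrm (r%:C *: (cunit : A)) <= r.
Proof. by move=> r0; rewrite nrmZr ger0_norm// ler_piMr// nrm1. Qed.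

Lemma nrm_le0 a : nrm a <= 0 -> a = 0.
Proof. by move=> h; apply: nrm_eq0; apply/eqP; rewrite eq_le h nrm_ge0. Qed.

Lemma eq_nrm_small a b : (forall e : R, 0 < e -> nrm (a - b) <= e) -> a = b.
Proof. exact: (eq_small banachA). Qed.

Lemma nclosed_eq (f g : A -> A) (k : R) :
  (forall x y, nrm (f x - f y) <= k * nrm (x - y)) ->
  (forall x y, nrm (g x - g y) <= k * nrm (x - y)) ->
  nclosed setT nrm [set x | f x = g x].
Proof.
move=> hf hg x _ hx; apply: eq_nrm_small => e e0.
have k0 : 0 < `|k| + 1 by rewrite ltr_wpDl.
have [y /= fgy hy] := hx (e / (`|k| + 1) / 2) (divr_gt0 (divr_gt0 e0 k0) (ltr0Sn _ 1)).
have h (q : A -> A) : (forall x y, nrm (q x - q y) <= k * nrm (x - y)) ->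
    nrm (q x - q y) <= e / 2.
  move=> hq; rewrite (le_trans (hq _ _))//.
  rewrite (@le_trans _ _ ((`|k| + 1) * nrm (x - y)))//.
    by rewrite ler_wpM2r ?nrm_ge0// (le_trans (ler_norm k))// lerDl.
  by rewrite mulrC -ler_pdivlMr// (le_trans hy)// mulrAC.
rewrite -[f x - g x](subrKA (f y)) (splitr e) (le_trans (nrmD _ _))//.
by rewrite lerD// ?(h f)// fgy nrm_distC (h g).
Qed.

Lemma nclosed_le r : nclosed setT nrm [set x | nrm x <= r].
Proof.
move=> x _ hx /=; apply/ler_addgt0Pl => e /hx[y /= hy xy].
by rewrite -[x](subrK y) (le_trans (nrmD _ _))// lerD.
Qed.

Lemma nrmMB_l c x y : nrm (c ** x - c ** y) <= nrm c * nrm (x - y).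
Proof. by rewrite -cmulBr nrmM. Qed.

Lemma nrmMB_r c x y : nrm (x ** c - y ** c) <= nrm c * nrm (x - y).
Proof. by rewrite -cmulBl mulrC nrmM. Qed.

End CStarNorm.

Ltac expand_products := rewrite ?(cmulDl, cmulDr, cmulNl, cmulNr, cmulZl, cmulZr,
  cmul0l, cmul0r, cmul1l, cmul1r, cmulA).

(** * Positive elements, their square roots and inverses *)

Section Positivity.
Context (R : realType) (A : cstarAlgType R).
Implicit Types (a b c d x y : A) (r s t : R).

Local Notation "\1" := (cunit : A) : ring_scope.
Local Notation commutant x := [set d : A | forall c, c ** x = x ** c -> c ** d = d ** c].

(** [commutant x] is the double commutant of [x]. Square roots and inverses are located there so
    that those of commuting elements commute with each other. *)
Lemma nclosed_commutant x : nclosed setT (@nrm _ A) (commutant x).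
Proof.
move=> d _ hd c cx.
apply: (@nclosed_eq _ _ (fun d => c ** d) (fun d => d ** c) (nrm c)) => //.
- exact: nrmMB_l.
- exact: nrmMB_r.
- by move=> e /hd[y hy dy]; exists y => //=; apply: hy.
Qed.

Lemma nclosed_selfadjoint : nclosed setT (@nrm _ A) [set d | star d = d].
Proof.
refine (@nclosed_eq _ _ (fun d : A => star d) (fun d => d) 1 _ _) => x y; rewrite mul1r//.
by rewrite -starB nrm_star.
Qed.

Lemma half_real : (2^-1)%:C = 2^-1 :> R[i].
Proof. by rewrite fmorphV rmorph_nat. Qed.

(** [(1 - d)^2 = 1 - x] amounts to [d = (x + d^2) / 2], and on the ball of radius [nrm x] the
    right-hand side contracts with ratio [nrm x]. *)
Lemma exists_sqrt1B x : star x = x -> nrm x < 1 ->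
  exists b, [/\ star b = b, b ** b = \1 - x, commutant x b & nrm (\1 - b) <= nrm x].
Proof.
move=> sx x1; pose D := [set d | [/\ star d = d, nrm d <= nrm x & commutant x d]].
pose f d := (2^-1)%:C *: (x + d ** d).
have fD d : D d -> D (f d).
  move=> [sd dx cd]; split; first by rewrite /f starZr starD starM sd sx.
  - rewrite /f nrmZr ger0_norm ?invr_ge0// mulrC ler_pdivrMr//.
    rewrite mulrDr mulr1 (le_trans (nrmD _ _))// lerD2l (le_trans (nrmM _ _))//.
    by rewrite (le_trans (ler_pM (nrm_ge0 _) (nrm_ge0 _) dx dx))// ler_piMr ?nrm_ge0 ?ltW.
  - move=> c cx; rewrite /f cmulZl cmulZr cmulDl cmulDr cx.
    by rewrite -(cmulA d d) -(cd _ cx) !cmulA (cd _ cx).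
have [||||||d [sd dx cd] fd] := @contraction _ _ _ _ (banachA A) D f (nrm x) 0.
- by [].
- move=> d _ hd; split.
  + by apply: nclosed_selfadjoint => // e /hd[y [? _ _] ?]; exists y.
  + by apply: (@nclosed_le _ _ (nrm x)) => // e /hd[y [_ ? _] ?]; exists y.
  + by apply: (@nclosed_commutant x) => // e /hd[y [_ _ ?] ?]; exists y.
- by split; rewrite ?star0 ?nrm0 ?nrm_ge0// => c _; rewrite cmul0l cmul0r.
- exact: fD.
- by rewrite nrm_ge0.
- move=> d e [_ dx _] [_ ex _].
  have -> : f d - f e = (2^-1)%:C *: (d ** (d - e) + (d - e) ** e).
    by rewrite /f; expand_products; lmodule R[i]; ring.
  rewrite nrmZr ger0_norm ?invr_ge0// mulrC ler_pdivrMr//.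
  rewrite (le_trans (nrmD _ _))//.
  have h1 := nrmM d (d - e); have h2 := nrmM (d - e) e.
  have h3 := ler_wpM2r (nrm_ge0 (d - e)) dx.
  have h4 := ler_wpM2l (nrm_ge0 (d - e)) ex.
  by lra.
have hd : d ** d = d + d - x.
  rewrite -[in RHS]fd /f half_real.
  by lmodule R[i]; field.
exists (\1 - d); split.
- by rewrite starB star1 sd.
- by expand_products; rewrite hd; lmodule R[i]; ring.
- by move=> c cx; expand_products; rewrite cd.
- by rewrite opprB addrC subrK.
Qed.

(** The Neumann series, obtained as the fixed point of [d |-> 1 + x d]. *)
Lemma exists_inv1B x : star x = x -> nrm x < 1 ->
  exists b, [/\ star b = b, b ** (\1 - x) = \1, (\1 - x) ** b = \1 & commutant x b].
Proof.
move=> sx x1; pose D := [set d | star d = d /\ commutant x d].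
pose f d := \1 + x ** d.
have [||||||d [sd cd] fd] := @contraction _ _ _ _ (banachA A) D f (nrm x) 0.
- by [].
- move=> d _ hd; split.
  + by apply: nclosed_selfadjoint => // e /hd[y [? _] ?]; exists y.
  + by apply: (@nclosed_commutant x) => // e /hd[y [_ ?] ?]; exists y.
- by split; rewrite ?star0// => c _; rewrite cmul0l cmul0r.
- move=> d [sd cd]; split; first by rewrite /f starD star1 starM sd sx cd.
  by move=> c cx; rewrite /f; expand_products; rewrite -[in RHS]cmulA -cd// cmulA cx.
- by rewrite nrm_ge0.
- move=> d e _ _; rewrite /f.
  have -> : \1 + x ** d - (\1 + x ** e) = x ** (d - e).
    by expand_products; lmodule R[i]; ring.
  exact: nrmM.
have hx : x ** d = d - \1 by rewrite -[in RHS]fd /f addrC addKr.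
by exists d; split=> //; expand_products; rewrite -?(cd x erefl) hx opprB addrC subrK.
Qed.

(* Equivalent to having nonnegative spectrum, but phrased with the norm only. *)
Definition pos a : Prop := star a = a /\ exists t, nrm (t%:C *: \1 - a) <= t.

Lemma posD a b : pos a -> pos b -> pos (a + b).
Proof.
move=> [sa [t ht]] [sb [s hs]]; split; first by rewrite starD sa sb.
exists (t + s); rewrite (le_trans _ (lerD ht hs))// (le_trans _ (nrmD _ _))//.
by rewrite rmorphD /= scalerDl opprD addrACA.
Qed.

Lemma posZ r a : 0 <= r -> pos a -> pos (r%:C *: a).
Proof.
move=> r0 [sa [t ht]]; split; first by rewrite starZr sa.
exists (r * t); rewrite rmorphM /= -scalerA -scalerBr nrmZr ger0_norm//.
by rewrite ler_wpM2l.
Qed.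

Lemma pos0 : pos 0.
Proof. by split; rewrite ?star0//; exists 0; rewrite scale0r subr0 nrm0. Qed.

Lemma pos_scalar r : 0 <= r -> pos (r%:C *: \1).
Proof.
move=> r0; split; first by rewrite starZr star1.
by exists r; rewrite subrr nrm0.
Qed.

Lemma pos_nrmB a t : star a = a -> nrm a <= t -> pos (t%:C *: \1 - a).
Proof.
move=> sa ha; split; first by rewrite starB starZr star1 sa.
by exists t; rewrite opprB addrC subrK.
Qed.

(* With [h] of norm less than 1, [sqrt (1 - h^2) + i h] is unitary, so its real part has norm at most 1. *)
Lemma nrm_1B_sqr h : star h = h -> nrm h < 1 -> nrm (\1 - h ** h) <= 1.
Proof.
move=> sh h1.
have hh : nrm (h ** h) < 1.
  by rewrite (le_lt_trans (nrmM _ _))// mulr_ilt1 ?nrm_ge0.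
have [|k [sk kk ck _]] := exists_sqrt1B _ hh; first by rewrite starM sh.
have hk : h ** k = k ** h by apply: ck; rewrite cmulA.
pose u := k + 'i%C *: h.
have su : star u = k - 'i%C *: h.
  rewrite /u starD starZc sk sh; congr (_ + _); rewrite -scaleNr; congr (_ *: _).
  by apply/eqP; rewrite eq_complex /= oppr0 !eqxx.
have uu : star u ** u = \1.
  rewrite su /u; expand_products; rewrite kk hk -[h ** h](opprK) -[h ** h](subKr \1) -kk.
  by lmodule R[i]; ring: (@sqr_i R).
have u1 : nrm u <= 1.
  by rewrite -(@ler_pXn2r _ 2) ?nnegrE ?nrm_ge0// -nrm_sq uu expr1n nrm1.
have k1 : nrm k <= 1.
  have -> : k = (2^-1)%:C *: (u + star u).
    by rewrite su /u half_real; lmodule R[i]; field.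
  rewrite nrmZr ger0_norm ?invr_ge0// mulrC ler_pdivrMr//.
  by rewrite (le_trans (nrmD _ _))// nrm_star; lra.
by rewrite -kk (le_trans (nrmM _ _))// mulr_ile1 ?nrm_ge0.
Qed.

Lemma nrmB_sqr h t : star h = h -> 0 < t -> nrm h ^+ 2 < t ->
  nrm (t%:C *: \1 - h ** h) <= t.
Proof.
move=> sh t0 ht.
have r0 : 0 < Num.sqrt t by rewrite sqrtr_gt0.
have rt : Num.sqrt t ^+ 2 = t by rewrite sqr_sqrtr// ltW.
have h1 : nrm ((Num.sqrt t)^-1%:C *: h) < 1.
  rewrite nrmZr gtr0_norm ?invr_gt0// mulrC ltr_pdivrMr// mul1r.
  by rewrite -(@ltr_pXn2r _ 2) ?nnegrE ?nrm_ge0 ?rt ?ltW.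
have sk : star ((Num.sqrt t)^-1%:C *: h) = (Num.sqrt t)^-1%:C *: h.
  by rewrite starZr sh.
have := nrm_1B_sqr sk h1; rewrite -(ler_pM2l t0) mulr1 -{1}(gtr0_norm t0) -nrmZr.
apply: le_trans; rewrite le_eqVlt; apply/orP; left; apply/eqP; congr nrm.
rewrite -{1 2}rt cmulZl cmulZr rmorphXn fmorphV /=.
lmodule R[i]; first by field; rewrite fmorph_eq0 gt_eqF.
by field; rewrite fmorph_eq0 gt_eqF.
Qed.

Lemma pos_sqr h : star h = h -> pos (h ** h).
Proof.
move=> sh; split; first by rewrite starM sh.
exists (nrm h ^+ 2 + 1); apply: nrmB_sqr => //.
  by rewrite ltr_wpDl// exprn_ge0// nrm_ge0.
by rewrite ltrDl.
Qed.

(** If [t - a] has norm at most [t], then [(t - a) / (t + e)] has norm less than 1. The shift by [e]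
    thus brings [a] within reach of the two fixed-point lemmas, which degenerate at norm 1. *)
Lemma pos_shift a e : pos a -> 0 < e -> exists (t : R) x,
  [/\ 0 < t, star x = x, nrm x < 1, a + e%:C *: \1 = t%:C *: (\1 - x)
    & forall c, c ** a = a ** c -> c ** x = x ** c].
Proof.
move=> [sa [t ht]] e0; have t0 : 0 <= t by apply: le_trans ht; apply: nrm_ge0.
have te : 0 < t + e by rewrite ltr_wpDl.
have te' : (t + e)%:C != 0 :> R[i] by rewrite fmorph_eq0 gt_eqF.
exists (t + e), ((t + e)^-1%:C *: (t%:C *: \1 - a)); split=> //.
- by rewrite starZr starB starZr star1 sa.
- rewrite nrmZr gtr0_norm ?invr_gt0// mulrC ltr_pdivrMr// mul1r.
  by rewrite (le_lt_trans ht)// ltrDl.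
- rewrite fmorphV /=; move: te'; rewrite rmorphD /= => te'.
  by lmodule R[i]; field.
- by move=> c ca; expand_products; rewrite ca.
Qed.

Lemma pos_sqrt a e : pos a -> 0 < e -> exists b,
  [/\ star b = b, b ** b = a + e%:C *: \1 & commutant a b].
Proof.
move=> pa e0; have [t [x [t0 sx x1 ae cx]]] := pos_shift pa e0.
have [b [sb bb cb _]] := exists_sqrt1B sx x1.
exists ((Num.sqrt t)%:C *: b); split.
- by rewrite starZr sb.
- rewrite cmulZl cmulZr scalerA bb -rmorphM /= -expr2 sqr_sqrtr ?ltW//.
- by move=> c /cx/cb h; expand_products; rewrite h.
Qed.

Lemma pos_inv a e : pos a -> 0 < e -> exists b,
  [/\ star b = b, b ** (a + e%:C *: \1) = \1, (a + e%:C *: \1) ** b = \1 & commutant a b].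
Proof.
move=> pa e0; have [t [x [t0 sx x1 -> cx]]] := pos_shift pa e0.
have t1 : t%:C != 0 :> R[i] by rewrite fmorph_eq0 gt_eqF.
have [b [sb b1 b2 cb]] := exists_inv1B sx x1.
exists (t^-1%:C *: b); split; first by rewrite starZr sb.
- by rewrite cmulZl cmulZr scalerA b1 fmorphV mulVf// scale1r.
- by rewrite cmulZl cmulZr scalerA b2 fmorphV mulfV// scale1r.
- by move=> c /cx/cb h; expand_products; rewrite h.
Qed.

(** Any upper bound of the norm serves as the witness in [pos]: up to [e], the element [a] is a
    square [b ** b] with [nrm b ^+ 2 <= t + e], and [nrmB_sqr] applies. A witness depending on the
    norm alone is what makes positivity a closed condition. *)
Lemma pos_nrm_le a t : pos a -> nrm a <= t -> nrm (t%:C *: \1 - a) <= t.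
Proof.
move=> pa ha; apply/ler_addgt0Pl => e' e'0; pose e := e' / 3.
have e0 : 0 < e by rewrite divr_gt0.
have ee : e' = e + e + e by rewrite /e; lra.
have t0 : 0 <= t by apply: le_trans ha; apply: nrm_ge0.
have [b [sb bb _]] := pos_sqrt pa e0.
have n1 := nrm_scalar A (ltW e0).
have hb : nrm b ^+ 2 < t + 2 * e.
  rewrite -nrm_sq sb bb; have := nrmD a (e%:C *: \1); lra.
have := nrmB_sqr sb (le_lt_trans (exprn_ge0 _ (nrm_ge0 _)) hb) hb; rewrite bb => h.
have -> : t%:C *: \1 - a = ((t + 2 * e)%:C *: \1 - (a + e%:C *: \1)) - e%:C *: \1.
  by lmodule R[i]; ring.
by have := nrmB ((t + 2 * e)%:C *: \1 - (a + e%:C *: \1)) (e%:C *: \1); lra.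
Qed.

Lemma nclosed_pos : nclosed setT (@nrm _ A) pos.
Proof.
move=> a _ ha; split.
  by apply: nclosed_selfadjoint => // e /ha[y [? _] ?]; exists y.
(* A single witness valid for every approximant within distance 1 of [a]. *)
exists (nrm a + 1); apply/ler_addgt0Pl => e e0.
pose e1 := Num.min e 1.
have e10 : 0 < e1 by rewrite lt_min e0 ltr01.
have [b pb ab] := ha _ e10.
have hb : nrm b <= nrm a + 1.
  have h1 : e1 <= 1 by rewrite ge_min lexx orbT.
  have := nrmB a (a - b); rewrite opprB addrC subrK; lra.
have := pos_nrm_le pb hb.
have -> : (nrm a + 1)%:C *: \1 - a = ((nrm a + 1)%:C *: \1 - b) - (a - b).
  by lmodule R[i]; ring.
have := nrmB ((nrm a + 1)%:C *: \1 - b) (a - b).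
have : e1 <= e by rewrite ge_min lexx.
lra.
Qed.

Lemma pos_eps a : (forall e, 0 < e -> pos (a + e%:C *: \1)) -> pos a.
Proof.
move=> h; apply: nclosed_pos => // e e0; exists (a + e%:C *: \1); first exact: h.
by rewrite opprD addNKr nrmN nrm_scalar// ltW.
Qed.

(** With commuting square roots [b] of [a + e] and [c] of [t - a + e], the element [u = b + i c]
    satisfies [star u ** u = t + 2 e]. Since [b] is the real part of [u], its norm is at most that
    of [u]. *)
Lemma pos_nrm a t : pos a -> pos (t%:C *: \1 - a) -> 0 <= t -> nrm a <= t.
Proof.
move=> pa pt t0; apply/ler_addgt0Pl => e' e'0; pose e := e' / 3.
have e0 : 0 < e by rewrite divr_gt0.
have ee : e' = e + e + e by rewrite /e; lra.
have [b [sb bb cb]] := pos_sqrt pa e0.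
have [c [sc cc ccm]] := pos_sqrt pt e0.
have bc : b ** c = c ** b.
  apply: ccm; expand_products; congr (_ - _); apply/esym/cb.
  by [].
have hbc : star (b + 'i%C *: c) ** (b + 'i%C *: c) = (t + 2 * e)%:C *: \1.
  rewrite starD starZc sb sc.
  rewrite conjci.
  expand_products; rewrite bb cc bc.
  by lmodule R[i]; rewrite ?rmorphD ?rmorphM /=; ring: (@sqr_i R).
have b2 : b = (2^-1)%:C *: ((b + 'i%C *: c) + star (b + 'i%C *: c)).
  rewrite starD starZc sb sc.
  rewrite conjci.
  by rewrite half_real; lmodule R[i]; field.
have hb : nrm b <= nrm (b + 'i%C *: c).
  rewrite {1}b2 nrmZr ger0_norm ?invr_ge0// mulrC ler_pdivrMr//.
  by rewrite (le_trans (nrmD _ _))// nrm_star; lra.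
have hb2 : nrm b ^+ 2 <= t + 2 * e.
  rewrite (@le_trans _ _ (nrm (b + 'i%C *: c) ^+ 2))//.
    by rewrite ler_pXn2r ?nnegrE ?nrm_ge0.
  by rewrite -nrm_sq hbc nrm_scalar//; lra.
move: hb2; rewrite -nrm_sq sb bb.
have -> : a = (a + e%:C *: \1) - e%:C *: \1 by rewrite addrK.
have := nrmB (a + e%:C *: \1) (e%:C *: \1); have := nrm_scalar A (ltW e0).
rewrite addrK; lra.
Qed.

Lemma pos_le_nrm a b : pos a -> pos (b - a) -> nrm a <= nrm b.
Proof.
move=> pa pab; apply: pos_nrm => //; last exact: nrm_ge0.
have -> : (nrm b)%:C *: \1 - a = ((nrm b)%:C *: \1 - b) + (b - a) by rewrite subrKA.
apply: posD => //; apply: pos_nrmB => //.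
by rewrite -(subrK a b) starD pab.1 pa.1.
Qed.

(** The square roots of [a + e] and [b + e] commute, so [(a + e) ** (b + e)] is the square of their
    product; it differs from [a ** b] by [e (a + b + e)], which [e * k] bounds in norm. *)
Lemma posM a b : pos a -> pos b -> a ** b = b ** a -> pos (a ** b).
Proof.
move=> pa pb ab; apply: nclosed_pos => // e' e'0.
pose k := nrm a + nrm b + 1.
have k0 : 0 < k by rewrite /k ltr_wpDl ?addr_ge0 ?nrm_ge0.
pose e := Num.min (e' / k) 1.
have e0 : 0 < e by rewrite lt_min divr_gt0//= ltr01.
have [c [sc cc ccm]] := pos_sqrt pa e0.
have [d [sd dd dcm]] := pos_sqrt pb e0.
have cd : c ** d = d ** c by apply: dcm; apply/esym/ccm; rewrite ab.
exists ((c ** d) ** (c ** d)); first by apply: pos_sqr; rewrite starM sc sd cd.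
have -> : c ** d ** (c ** d) = (a + e%:C *: \1) ** (b + e%:C *: \1).
  by rewrite -cc -dd -!cmulA; congr (_ ** _); rewrite !cmulA -cd.
have -> : a ** b - (a + e%:C *: \1) ** (b + e%:C *: \1) =
    - (e%:C *: (a + b + e%:C *: \1)).
  by expand_products; lmodule R[i]; ring.
rewrite nrmN nrmZr gtr0_norm//.
have ek : e * k <= e' by rewrite -ler_pdivlMr// ge_min lexx.
have e1 : e <= 1 by rewrite ge_min lexx orbT.
rewrite (le_trans _ ek)// ler_pM2l// /k.
have := nrmD (a + b) (e%:C *: \1); have := nrmD a b.
by have := nrm_scalar A (ltW e0); lra.
Qed.

End Positivity.

(** * Positivity of [star a ** a] *)

Section PositivityOfSquares.
Context (R : realType) (A : cstarAlgType R).
Implicit Types (a b c d h x y z : A) (r s t : R).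

Local Notation "\1" := (cunit : A) : ring_scope.

(** Replaces an argument on the least spectral value. The infimum of the shifts [l >= 0] making
    [h + l] positive is attained because positivity is closed, and the hypothesis would lower it if
    it were not 0. *)
Lemma pos_descent h : star h = h ->
  (forall l : R, 0 < l -> pos (h + l%:C *: \1) ->
     exists2 e, 0 < e & pos (h + l%:C *: \1 - e%:C *: \1)) -> pos h.
Proof.
move=> sh hh; pose S := [set l : R | 0 <= l /\ pos (h + l%:C *: \1)].
have S0 : S (nrm h).
  split; first exact: nrm_ge0.
  by rewrite addrC -[h]opprK; apply: pos_nrmB; rewrite ?starN ?sh ?nrmN.
have infS : has_inf S by split; [exists (nrm h)|exists 0 => x []].
have l0 : 0 <= inf S by apply: lb_le_inf infS.1 _ => x [].
have Sl : pos (h + (inf S)%:C *: \1).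
  apply: pos_eps => e e0; have [l [l1 pl] le] := inf_adherent e0 infS.
  have -> : h + (inf S)%:C *: \1 + e%:C *: \1 =
      h + l%:C *: \1 + (inf S + e - l)%:C *: \1 by lmodule R[i]; ring.
  by apply: posD => //; apply: pos_scalar; rewrite subr_ge0 ltW.
have [l1|l1] := ltP 0 (inf S); last first.
  by move: Sl; rewrite (le_anti (introT andP (conj l1 l0))) scale0r addr0.
have [e e0 pe] := hh _ l1 Sl.
pose e' := Num.min e (inf S).
have e'0 : 0 < e' by rewrite lt_min e0.
have : S (inf S - e').
  split; first by rewrite subr_ge0 ge_min lexx orbT.
  have -> : h + (inf S - e')%:C *: \1 =
      h + (inf S)%:C *: \1 - e%:C *: \1 + (e - e')%:C *: \1 by lmodule R[i]; ring.
  by apply: posD => //; apply: pos_scalar; rewrite subr_ge0 ge_min lexx.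
by move=> /(ge_inf infS.2); rewrite lerBrDl gerDr leNgt e'0.
Qed.

(** The inverse [z] is positive and lies below [nrm z + 1]; multiplying this inequality by the
    commuting [y] gives [1 <= (nrm z + 1) y]. *)
Lemma pos_inv_gt y z : pos y -> y ** z = \1 -> z ** y = \1 ->
  exists2 e, 0 < e & pos (y - e%:C *: \1).
Proof.
move=> py yz zy.
have sz : star z = z.
  have : star z ** y = \1 by rewrite -{1}py.1 -starM yz star1.
  by move=> /(congr1 (fun w => w ** z)); rewrite -cmulA yz cmul1l cmul1r.
have pz : pos z.
  have -> : z = y ** (z ** z) by rewrite cmulA yz cmul1l.
  apply: posM => //; first exact: pos_sqr.
  by rewrite cmulA yz -cmulA zy cmul1l cmul1r.
have n0 : 0 < nrm z + 1 by rewrite ltr_wpDl ?nrm_ge0.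
have pw : pos ((nrm z + 1)%:C *: \1 - z) by apply: pos_nrmB => //; rewrite lerDl.
have := posM pw py; rewrite cmulBl cmulBr zy yz cmulZl cmulZr cmul1l cmul1r => /(_ erefl) h.
exists (nrm z + 1)^-1; first by rewrite invr_gt0.
have := posZ (ltW (_ : 0 < (nrm z + 1)^-1)) h; rewrite invr_gt0 => /(_ n0).
rewrite scalerBr scalerA -rmorphM /= mulVf ?gt_eqF//.
by rewrite rmorph1 scale1r.
Qed.

(* The nonzero spectra of [b* b] and [b b*] agree: [(1 + b z b* ) / m] inverts [m - b b*] when [z] inverts [m - b* b]. *)
Lemma pos_flip b r : 0 <= r -> pos (r%:C *: \1 - star b ** b) ->
  pos (r%:C *: \1 - b ** star b).
Proof.
move=> r0 pb; apply: pos_descent; first by rewrite starB starZr star1 starM starK.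
move=> l l0 pl; have [z [sz z1 z2 _]] := pos_inv pb l0.
pose m := r + l; have m0 : 0 < m by rewrite ltr_wpDl.
have m1 : m%:C != 0 by rewrite fmorph_eq0 gt_eqF.
have e1 : r%:C *: \1 - star b ** b + l%:C *: \1 = m%:C *: \1 - star b ** b.
  by rewrite /m; lmodule R[i]; ring.
have e2 : r%:C *: \1 - b ** star b + l%:C *: \1 = m%:C *: \1 - b ** star b.
  by rewrite /m; lmodule R[i]; ring.
rewrite e2 in pl *; rewrite e1 in z1 z2.
apply: (@pos_inv_gt _ (m^-1%:C *: (\1 + b ** z ** star b))) => //.
  have : b ** ((m%:C *: \1 - star b ** b) ** z) ** star b = b ** star b.
    by rewrite z2 cmul1r.
  expand_products; set p := b ** star b ** b ** z ** star b.
  move=> h; have -> : p = m%:C *: (b ** z ** star b) - b ** star b.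
    by rewrite -h; lmodule R[i]; ring.
  by rewrite fmorphV; lmodule R[i]; field.
have : b ** (z ** (m%:C *: \1 - star b ** b)) ** star b = b ** star b.
  by rewrite z1 cmul1r.
expand_products; set p := b ** z ** star b ** b ** star b.
move=> h; have -> : p = m%:C *: (b ** z ** star b) - b ** star b.
  by rewrite -h; lmodule R[i]; ring.
by rewrite fmorphV; lmodule R[i]; field.
Qed.

(** Half the sum of the squares of the self-adjoint elements [b + star b] and [i (b - star b)]. *)
Lemma pos_sum_flip b : pos (b ** star b + star b ** b).
Proof.
pose u := b + star b; pose v := 'i%C *: (b - star b).
have su : star u = u by rewrite /u starD starK addrC.
have sv : star v = v.
  rewrite /v starZc starB starK.
  rewrite conjci.
  by rewrite scaleNr -scalerN opprB.
have -> : b ** star b + star b ** b = (2^-1)%:C *: (u ** u + v ** v).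
  by rewrite half_real /u /v; expand_products; lmodule R[i]; field: (@sqr_i R).
by apply: posZ; rewrite ?invr_ge0//; apply: posD; apply: pos_sqr.
Qed.

(* Kelley-Vaught. If [h = a* a >= -l], then [b = a (h + 2l)^-1] satisfies [b* b <= 1/(8l)], hence [b b* <= 1/(8l)] and [b* b >= - b b* >= -1/(8l)]; solving the last inequality for [h] improves the bound [h >= -l]. *)
Lemma pos_star_mul a : pos (star a ** a).
Proof.
have [h hE] : exists h, h = star a ** a by exists (star a ** a).
have sh : star h = h by rewrite hE starM starK.
rewrite -hE.
apply: pos_descent => // l l0 pl; have [r [sr r1 r2 cr]] := pos_inv pl l0.
have l1 : l%:C != 0 :> R[i] by rewrite fmorph_eq0 gt_eqF.
have [g gE] : exists g, g = h + l%:C *: \1 by exists (h + l%:C *: \1).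
have [w wE] : exists w, w = g + l%:C *: \1 by exists (g + l%:C *: \1).
rewrite -gE -wE in r1 r2 *.
have hr : h ** r = \1 - (2 * l)%:C *: r.
  by rewrite -r2 wE gE; expand_products; lmodule R[i]; ring.
pose b := a ** r; pose k := \1 - (4 * l)%:C *: r.
have bb : star b ** b = r - (2 * l)%:C *: (r ** r).
  rewrite /b starM sr cmulA -(cmulA r) -hE -cmulA hr.
  by expand_products; lmodule R[i]; ring.
(* [1 / (8 l)] is the maximum of [t - 2 l t^2], reached at [t = 1 / (4 l)]; hence the perfect square
   [e k^2] below. *)
pose e := (8 * l)^-1; have e0 : 0 < e by rewrite invr_gt0 mulr_gt0.
have eC : e%:C = (8 * l%:C)^-1 by rewrite /e fmorphV rmorphM rmorph_nat.
have pb : pos (e%:C *: \1 - star b ** b).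
  have -> : e%:C *: \1 - star b ** b = e%:C *: (k ** k).
    rewrite bb eC /k; expand_products; lmodule R[i]; field => //.
  apply: posZ; rewrite ?ltW//; apply: pos_sqr.
  by rewrite /k starB star1 starZr sr.
have pb' := posD (pos_flip (ltW e0) pb) (pos_sum_flip b).
rewrite addrA subrK bb in pb'.
have sw : star w = w by rewrite wE gE !starD !starZr !star1 sh.
have rww : r ** w ** w = w by rewrite r1 cmul1l.
have rrww : r ** r ** w ** w = \1 by rewrite -(cmulA r r) r1 cmul1r r1.
have wwr : w ** w ** r = w by rewrite -cmulA r2 cmul1r.
have := posM pb' (pos_sqr sw); expand_products.
rewrite rww rrww wwr r2 => /(_ erefl) pw.
pose s := nrm g; have sg : star g = g by rewrite gE starD starZr star1 sh.
have pg : pos (g ** (s%:C *: \1 - g)).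
  apply: posM => //; [by rewrite gE|exact: pos_nrmB|by expand_products].
have s0 : 0 < s + 10 * l by rewrite ltr_wpDl ?nrm_ge0 ?mulr_gt0.
(* Multiplying [1 / (8 l) + star b ** b >= 0] by [8 l w^2] gives [g^2 + 10 l g >= 7 l^2]. Together
   with [g^2 <= s g] this bounds [g] below by the constant chosen here. *)
exists (7 * l ^+ 2 / (s + 10 * l)).
  by rewrite divr_gt0// mulr_gt0// exprn_gt0.
have := posZ (ltW (divr_gt0 ltr01 s0)) (posD (posZ (ltW (_ : 0 < 8 * l)) pw) pg).
rewrite mulr_gt0// => /(_ isT).
congr pos; rewrite eC wE; expand_products.
have s1 : (s%:C + 10 * l%:C) != 0.
  by have := s0; rewrite -ltcR rmorphD rmorphM rmorph_nat /= => /gt_eqF ->.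
lmodule R[i]; field; rewrite ?s1 //.
Qed.

(** Writing [b + e = c ** c] with [c] self-adjoint exhibits the element as a limit of
    [star (c ** a) ** (c ** a)]. *)
Lemma pos_conj a b : pos b -> pos (star a ** b ** a).
Proof.
move=> pb; apply: nclosed_pos => // e e0.
have n0 : 0 < nrm (star a ** a) + 1 by rewrite ltr_wpDl ?nrm_ge0.
have [c [sc cc _]] := pos_sqrt pb (divr_gt0 e0 n0).
exists (star (c ** a) ** (c ** a)); first exact: pos_star_mul.
rewrite starM sc cmulA -(cmulA (star a) c) cc.
have -> : star a ** b ** a - star a ** (b + (e / (nrm (star a ** a) + 1))%:C *: \1) ** a
    = - ((e / (nrm (star a ** a) + 1))%:C *: (star a ** a)).
  by expand_products; lmodule R[i]; ring.
rewrite nrmN nrmZr gtr0_norm ?divr_gt0// -mulrA ger_pMr// mulrC.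
by rewrite ler_pdivrMr// mul1r lerDl.
Qed.

Lemma pos_conj_le a b t : star b = b -> nrm b <= t ->
  pos (t%:C *: (star a ** a) - star a ** b ** a).
Proof.
move=> sb bt; have := pos_conj a (pos_nrmB sb bt).
by congr pos; expand_products.
Qed.

End PositivityOfSquares.

(** * Positive A-valued forms *)

Section Forms.
Context (R : realType) (A : cstarAlgType R).
Implicit Types (a b c : A) (r s t : R).

Local Notation "\1" := (cunit : A) : ring_scope.

Lemma nrmZ (k : R[i]) a : nrm (k *: a) = complex.Re `|k| * nrm a.
Proof.
by apply: complexI; rewrite rmorphM -[LHS]nrmE normrZ nrmE; congr (_ * _).
Qed.

Lemma pos_sum (I : Type) (s : seq I) (P : pred I) (F : I -> A) :
  (forall i, P i -> pos (F i)) -> pos (\sum_(i <- s | P i) F i).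
Proof.
by move=> h; elim/big_ind: _ => //; [exact: pos0|exact: posD].
Qed.

Lemma star_sum (I : Type) (s : seq I) (P : pred I) (F : I -> A) :
  star (\sum_(i <- s | P i) F i) = \sum_(i <- s | P i) star (F i).
Proof. by elim/big_rec2: _ => [|i x y _ <-]; rewrite ?star0 ?starD. Qed.

Lemma cmul_suml (I : Type) (s : seq I) (P : pred I) (F : I -> A) a :
  (\sum_(i <- s | P i) F i) ** a = \sum_(i <- s | P i) F i ** a.
Proof. by elim/big_rec2: _ => [|i x y _ <-]; rewrite ?cmul0l ?cmulDl. Qed.

Lemma cmul_sumr (I : Type) (s : seq I) (P : pred I) (F : I -> A) a :
  a ** (\sum_(i <- s | P i) F i) = \sum_(i <- s | P i) a ** F i.
Proof. by elim/big_rec2: _ => [|i x y _ <-]; rewrite ?cmul0r ?cmulDr. Qed.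

(** Has two kinds of instances: the finite sums [part m n] on all sequences, which are needed before
    the series are known to converge, and the limit [inner] on the square-summable ones. *)
Record positive_form (V : lmodType R[i]) (E : set V) (phi : V -> V -> A) : Prop := {
  formED : forall x y, E x -> E y -> E (x + y) ;
  formEZ : forall (k : R[i]) x, E x -> E (k *: x) ;
  formDl : forall x y z, E x -> E y -> E z -> phi (x + y) z = phi x z + phi y z ;
  formDr : forall x y z, E x -> E y -> E z -> phi z (x + y) = phi z x + phi z y ;
  formZl : forall (k : R[i]) x y, E x -> E y -> phi (k *: x) y = conjc k *: phi x y ;
  formZr : forall (k : R[i]) x y, E x -> E y -> phi x (k *: y) = k *: phi x y ;
  form_pos : forall x, E x -> pos (phi x x) }.

Section Theory.
Context (V : lmodType R[i]) (E : set V) (phi : V -> V -> A).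
Hypothesis hphi : positive_form E phi.

Let ED := formED hphi.
Let EZ := formEZ hphi.

Definition form_norm x := Num.sqrt (nrm (phi x x)).

Lemma form_norm_ge0 x : 0 <= form_norm x.
Proof. exact: sqrtr_ge0. Qed.

Lemma form_norm_sqr x : form_norm x ^+ 2 = nrm (phi x x).
Proof. by rewrite sqr_sqrtr// nrm_ge0. Qed.

Lemma form_lin2 (k l : R[i]) x y : E x -> E y ->
  phi (k *: x + l *: y) (k *: x + l *: y) =
  (conjc k * k) *: phi x x + (conjc k * l) *: phi x y
    + (conjc l * k) *: phi y x + (conjc l * l) *: phi y y.
Proof.
move=> Ex Ey; have Ekx := EZ k Ex; have Ely := EZ l Ey.
have Ekl := ED Ekx Ely.
rewrite (formDl hphi)// !(formDr hphi)// !(formZl hphi)// !(formZr hphi)//.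
by rewrite !scalerA !addrA.
Qed.

(** The triangle inequality in the order of A, with a free parameter: the difference is [s^-1] times
    the form at [s x - y]. *)
Lemma form_add_le s x y : E x -> E y -> 0 < s ->
  pos ((1 + s)%:C *: phi x x + (1 + s^-1)%:C *: phi y y - phi (x + y) (x + y)).
Proof.
move=> Ex Ey s0; have s1 : s%:C != 0 :> R[i] by rewrite fmorph_eq0 gt_eqF.
have := form_pos hphi (ED (EZ s%:C Ex) (EZ (-1) Ey)).
move=> /(@posZ _ _ s^-1); rewrite invr_ge0 ltW// => /(_ isT).
have := form_lin2 1 1 Ex Ey; rewrite !scale1r => ->.
rewrite form_lin2// conjc_real conjc1.
rewrite conjcN1.
congr pos; rewrite rmorphD rmorph1 [(1 + _^-1)%:C]rmorphD rmorph1 fmorphV /=.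
by lmodule R[i]; field.
Qed.

Lemma form_norm_triangle x y : E x -> E y ->
  form_norm (x + y) <= form_norm x + form_norm y.
Proof.
move=> Ex Ey; apply/ler_addgt0Pl => e' e'0; pose e := e' / 2.
have e0 : 0 < e by rewrite divr_gt0.
have ee : e' = e + e by rewrite /e; lra.
set X := form_norm x; set Y := form_norm y.
have X0 : 0 < X + e by rewrite ltr_wpDl ?form_norm_ge0.
have Y0 : 0 < Y + e by rewrite ltr_wpDl ?form_norm_ge0.
(* The ratio [Y / X] minimises [(1 + s) X^2 + (1 + s^-1) Y^2], with value [(X + Y)^2]; [e] keeps it
   defined and positive when a norm vanishes. *)
have s0 := divr_gt0 Y0 X0; set s := (Y + e) / (X + e) in s0.
rewrite -(@ler_pXn2r _ 2) ?nnegrE ?form_norm_ge0//; last first.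
  by rewrite !addr_ge0 ?form_norm_ge0// ltW.
rewrite form_norm_sqr.
have := pos_le_nrm (form_pos hphi (ED Ex Ey)) (form_add_le Ex Ey s0).
have := nrmD ((1 + s)%:C *: phi x x) ((1 + s^-1)%:C *: phi y y).
have s1 : 0 < 1 + s by rewrite addr_gt0.
have s2 : 0 < 1 + s^-1 by rewrite addr_gt0 ?invr_gt0.
rewrite !nrmZr !gtr0_norm// -!form_norm_sqr => h1 h2.
apply: (le_trans h2); apply: (le_trans h1).
rewrite -/X -/Y.
have -> : (e' + (X + Y)) ^+ 2 = (1 + s) * (X + e) ^+ 2 + (1 + s^-1) * (Y + e) ^+ 2.
  by rewrite /s ee; field; rewrite !gt_eqF.
apply: lerD; rewrite ler_pM2l// ler_pXn2r ?nnegrE ?lerDl ?form_norm_ge0 ?ltW//.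
Qed.

Lemma form_unit_le (k : R[i]) x y : E x -> E y -> conjc k * k = 1 ->
  nrm (phi (x + k *: y) (x + k *: y)) <= 2 * nrm (phi x x) + 2 * nrm (phi y y).
Proof.
move=> Ex Ey kk; have Eky := EZ k Ey.
have := pos_le_nrm (form_pos hphi (ED Ex Eky)) (form_add_le Ex Eky ltr01).
move=> /le_trans; apply; rewrite invr1 (le_trans (nrmD _ _))// !nrmZr.
rewrite (ger0_norm (addr_ge0 ler01 ler01)) -!mulr2n.
by rewrite (formZl hphi)// (formZr hphi)// scalerA kk scale1r.
Qed.

Lemma form_polarization x y : E x -> E y -> 4 *: phi x y =
  phi (x + 1 *: y) (x + 1 *: y) - phi (x + (-1) *: y) (x + (-1) *: y)
  - 'i%C *: phi (x + 'i%C *: y) (x + 'i%C *: y)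
  + 'i%C *: phi (x + (- 'i%C) *: y) (x + (- 'i%C) *: y).
Proof.
move=> Ex Ey; have h k := form_lin2 1 k Ex Ey; rewrite scale1r in h.
rewrite !{}h conjc1.
rewrite conjcN1 conjcNi conjci.
by lmodule R[i]; ring: (@sqr_i R).
Qed.

Lemma form_cauchy_sum x y : E x -> E y ->
  nrm (phi x y) <= 2 * nrm (phi x x) + 2 * nrm (phi y y).
Proof.
move=> Ex Ey; have h4 : 4%:R%:C = 4 :> R[i] by rewrite rmorph_nat.
suff : 4 * nrm (phi x y) <= 4 * (2 * nrm (phi x x) + 2 * nrm (phi y y)).
  by rewrite ler_pM2l.
have -> : 4 * nrm (phi x y) = nrm (4 *: phi x y).
  by rewrite -h4 nrmZr ger0_norm.
rewrite form_polarization//.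
have u1 := @form_unit_le 1 x y Ex Ey; have u2 := @form_unit_le (-1) x y Ex Ey.
have u3 := @form_unit_le 'i%C x y Ex Ey; have u4 := @form_unit_le (- 'i%C) x y Ex Ey.
rewrite conjc1 mulr1 in u1; rewrite conjcN1 mulrNN mulr1 in u2.
rewrite conjci mulNr -expr2 sqr_i opprK in u3; rewrite conjcNi mulrN -expr2 sqr_i opprK in u4.
move: (u1 erefl) (u2 erefl) (u3 erefl) (u4 erefl).
set p1 := phi _ _; set p2 := phi (_ + -1 *: _) _; set p3 := phi (_ + 'i%C *: _) _.
set p4 := phi (_ + - 'i%C *: _) _ => v1 v2 v3 v4.
have := nrmD (p1 - p2 - 'i%C *: p3) ('i%C *: p4).
have := nrmB (p1 - p2) ('i%C *: p3); have := nrmB p1 p2.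
by rewrite !nrm_i; lra.
Qed.

Lemma form_cauchy x y : E x -> E y ->
  nrm (phi x y) <= 4 * form_norm x * form_norm y.
Proof.
move=> Ex Ey; set X := form_norm x; set Y := form_norm y.
apply/ler_addgt0Pl => e e0.
(* [d] keeps the scaling factors [s] and [t] below defined when [x] or [y] has norm 0. After scaling
   both norms are at most 1, and [form_cauchy_sum] contributes the constant 2 + 2. *)
have [d d0 hd] : exists2 d, 0 < d & 4 * (X + d) * (Y + d) <= e + 4 * X * Y.
  have X0 : 0 <= X := form_norm_ge0 x; have Y0 : 0 <= Y := form_norm_ge0 y.
  have k0 : 0 < 4 * (X + Y + 1) by rewrite mulr_gt0// ltr_wpDl// addr_ge0.
  exists (Num.min 1 (e / (4 * (X + Y + 1)))).
    by rewrite lt_min ltr01 divr_gt0.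
  set d := Num.min _ _; have d1 : d <= 1 by rewrite ge_min lexx.
  have d0 : 0 <= d by rewrite le_min ler01 divr_ge0// ltW.
  have : d * (4 * (X + Y + 1)) <= e by rewrite -ler_pdivlMr// ge_min lexx orbT.
  have : d * d <= d by rewrite ler_piMr.
  lra.
apply: le_trans hd.
have X0 : 0 < X + d by rewrite ltr_wpDl ?form_norm_ge0.
have Y0 : 0 < Y + d by rewrite ltr_wpDl ?form_norm_ge0.
pose s := (X + d)^-1; pose t := (Y + d)^-1.
have s0 : 0 < s by rewrite invr_gt0. have t0 : 0 < t by rewrite invr_gt0.
have := form_cauchy_sum (EZ s%:C Ex) (EZ t%:C Ey).
have Etx := EZ s%:C Ex; have Ety := EZ t%:C Ey.
rewrite !(formZl hphi)// !(formZr hphi)// !conjc_real !nrmZr !gtr0_norm//.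
rewrite -!form_norm_sqr -/X -/Y => h.
have hX : s * (s * X ^+ 2) <= 1.
  rewrite mulrA /s -invfM ler_pdivrMl ?mulr_gt0// mulr1 -expr2.
  by rewrite ler_pXn2r ?nnegrE ?lerDl ?form_norm_ge0 ?ltW.
have hY : t * (t * Y ^+ 2) <= 1.
  rewrite mulrA /t -invfM ler_pdivrMl ?mulr_gt0// mulr1 -expr2.
  by rewrite ler_pXn2r ?nnegrE ?lerDl ?form_norm_ge0 ?ltW.
have : s * (t * nrm (phi x y)) <= 4 by lra.
by rewrite /s /t ler_pdivrMl// ler_pdivrMl// mulrA mulrC mulrA [4 * _]mulrC => h'; lra.
Qed.

End Theory.
End Forms.

(** * The Hilbert module l2(A) *)

Section L2.
Context (R : realType) (A : cstarAlgType R).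
Implicit Types (a b c : A) (r s t : R) (x y z : l2 A).

Local Notation tendsA := (tends (@nrm R A)).

Lemma tendsP (u : nat -> A) l : u @ \oo --> l <-> tendsA u l.
Proof.
split=> [/cvgrPdist_le ul e e0|ul].
  have ec0 : 0 < e%:C by rewrite -[0]/(0%:C) ltcR.
  by have [N _ hN] := ul _ ec0; exists N => n /hN /=; rewrite distrC nrmE lecR.
apply/cvgrPdist_le => e e0.
have eE : (complex.Re e)%:C = e by rewrite RRe_real// gtr0_real.
have [|N hN] := ul (complex.Re e); first by rewrite -ltcR eE.
by exists N => // n /hN /=; rewrite distrC nrmE -[in X in _ -> X]eE lecR.
Qed.

Lemma tends_unique (u : nat -> A) l l' : tendsA u l -> tendsA u l' -> l = l'.
Proof.
move=> ul ul'; apply: eq_nrm_small => e e0.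
have [N hN] := ul _ (divr_gt0 e0 (ltr0Sn _ 1)).
have [N' hN'] := ul' _ (divr_gt0 e0 (ltr0Sn _ 1)).
have h := hN _ (leq_maxl N N'); have h' := hN' _ (leq_maxr N N').
rewrite -(subrKA (u (maxn N N'))) (splitr e) (le_trans (nrmD _ _))//.
by rewrite lerD// nrm_distC.
Qed.

Lemma tendsD (u v : nat -> A) l m : tendsA u l -> tendsA v m ->
  tendsA (fun n => u n + v n) (l + m).
Proof.
move=> ul vm e e0; have e2 : 0 < e / 2 by rewrite divr_gt0.
have [N hN] := ul _ e2; have [M hM] := vm _ e2.
exists (maxn N M) => n; rewrite geq_max => /andP[/hN h1 /hM h2].
by rewrite opprD addrACA (splitr e) (le_trans (nrmD _ _))// lerD.
Qed.

Lemma tends_lip (f : A -> A) (k : R) (u : nat -> A) l : 0 <= k ->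
  (forall a b, nrm (f a - f b) <= k * nrm (a - b)) ->
  tendsA u l -> tendsA (fun n => f (u n)) (f l).
Proof.
move=> k0 hf ul e e0; have k1 : 0 < k + 1 by rewrite ltr_wpDl.
have [N hN] := ul _ (divr_gt0 e0 k1); exists N => n /hN h.
rewrite (le_trans (hf _ _))// (@le_trans _ _ ((k + 1) * nrm (u n - l)))//.
  by rewrite ler_wpM2r ?nrm_ge0// lerDl.
by rewrite mulrC -ler_pdivlMr.
Qed.

Lemma tendsM (u v : nat -> A) l m : tendsA u l -> tendsA v m ->
  tendsA (fun n => u n ** v n) (l ** m).
Proof.
move=> ul vm e e0; pose k := nrm l + nrm m + 1.
have k0 : 0 < k by rewrite ltr_wpDl// addr_ge0 ?nrm_ge0.
pose d := Num.min 1 (e / k).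
have d0 : 0 < d by rewrite lt_min ltr01 divr_gt0.
have d1 : d <= 1 by rewrite ge_min lexx.
have dk : d * k <= e by rewrite -ler_pdivlMr// ge_min lexx orbT.
have [N hN] := ul _ d0; have [M hM] := vm _ d0.
exists (maxn N M) => n; rewrite geq_max => /andP[/hN h1 /hM h2].
have -> : u n ** v n - l ** m = (u n - l) ** v n + l ** (v n - m).
  by expand_products; lmodule R[i]; ring.
have h3 : nrm (v n) <= nrm m + 1.
  by rewrite -[v n](subrK m) (le_trans (nrmD _ _))// addrC lerD// (le_trans h2).
rewrite (le_trans _ dk)// (le_trans (nrmD _ _))//.
have h4 := nrmM (u n - l) (v n); have h5 := nrmM l (v n - m).
have h6 := ler_pM (nrm_ge0 _) (nrm_ge0 _) h1 h3.
have h7 := ler_wpM2l (nrm_ge0 l) h2.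
by rewrite /k; lra.
Qed.

Lemma tends_pos (u : nat -> A) l N : (forall n, (N <= n)%N -> pos (u n)) ->
  tendsA u l -> pos l.
Proof.
move=> pu ul; apply: nclosed_pos => // e /ul[M hM].
exists (u (maxn N M)); first by apply: pu; rewrite leq_maxl.
by rewrite nrm_distC hM// leq_maxr.
Qed.

Lemma tends_const a : tendsA (fun=> a) a.
Proof. by move=> e e0; exists 0%N => n _; rewrite subrr nrm0 ltW. Qed.

Definition part (m n : nat) x y : A := \sum_(m <= i < n) star (x i) ** y i.

Lemma part_form m n : positive_form setT (part m n).
Proof.
split=> //.
- move=> x y z _ _ _; rewrite /part -big_split; apply: eq_bigr => i _.
  by rewrite /= -cmulDl -starD.
- move=> x y z _ _ _; rewrite /part -big_split; apply: eq_bigr => i _.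
  by rewrite /= -cmulDr.
- move=> k x y _ _; rewrite /part scaler_sumr; apply: eq_bigr => i _.
  by rewrite -cmulZl -starZc.
- move=> k x y _ _; rewrite /part scaler_sumr; apply: eq_bigr => i _.
  by rewrite -cmulZr.
- by move=> x _; apply: pos_sum => i _; apply: pos_star_mul.
Qed.

Lemma part_cat m n x y : (m <= n)%N -> part 0 n x y = part 0 m x y + part m n x y.
Proof. by move=> mn; rewrite /part (@big_cat_nat _ _ _ m). Qed.

Lemma part_le m n x : nrm (part m n x x) <= nrm (part 0 n x x).
Proof.
have [nm|mn] := leqP n m.
  by rewrite {1}/part big_geq// nrm0 nrm_ge0.
apply: pos_le_nrm; first by apply: (form_pos (part_form _ _)).
rewrite (part_cat x x (ltnW mn)) addrK.
by apply: (form_pos (part_form _ _)).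
Qed.

(** The Cauchy criterion: it reduces square-summability to estimates on finite windows, where the
    form inequalities are available. *)
Lemma eltsP x : @elts _ _ (l2 A) x <-> forall e : R, 0 < e ->
  exists N, forall m, (N <= m)%N -> forall n, nrm (part m n x x) <= e.
Proof.
split=> [/cvg_ex[l /tendsP ul] e e0|h].
  have [N hN] := ul _ (divr_gt0 e0 (ltr0Sn _ 1)).
  exists N => m Nm n; have [nm|/ltnW mn] := leqP n m.
    by rewrite /part big_geq// nrm0 ltW.
  have := hN _ (leq_trans Nm mn); have := hN _ Nm.
  rewrite -[series _ m]/(part 0 m x x) -[series _ n]/(part 0 n x x).
  have -> : part m n x x = (part 0 n x x - l) - (part 0 m x x - l).
    by rewrite opprB subrKA (part_cat x x mn) [in RHS]addrC addKr.
  by move=> h1 h2; rewrite (splitr e) (le_trans (nrmB _ _))// lerD.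
have [|l _ /tendsP ul] := banach_complete (banachA A) (u := fun n => part 0 n x x) (fun=> I).
  move=> e e0; have [N hN] := h _ e0; exists N.
  have hh m n : (m <= n)%N -> (N <= m)%N -> nrm (part 0 n x x - part 0 m x x) <= e.
    move=> mn Nm; rewrite (part_cat x x mn) [X in nrm X]addrC addKr.
    exact: hN.
  move=> m n Nm Nn; have [mn|/ltnW nm] := leqP m n; last exact: hh.
  by rewrite nrm_distC hh.
by apply/cvg_ex; exists l.
Qed.

Lemma eltsD x y : @elts _ _ (l2 A) x -> @elts _ _ (l2 A) y -> @elts _ _ (l2 A) (x + y).
Proof.
move=> /eltsP hx /eltsP hy; apply/eltsP => e e0.
have e4 : 0 < e / 4 by rewrite divr_gt0.
have [N hN] := hx _ e4; have [M hM] := hy _ e4.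
exists (maxn N M) => m; rewrite geq_max => /andP[hm hm'] n.
have h1 := hN _ hm n; have h2 := hM _ hm' n.
have := @form_unit_le _ _ _ _ _ (part_form m n) 1 x y I I.
by rewrite conjc1 mulr1 scale1r => /(_ erefl); lra.
Qed.

Lemma eltsZ (k : R[i]) x : @elts _ _ (l2 A) x -> @elts _ _ (l2 A) (k *: x).
Proof.
move=> /eltsP hx; apply/eltsP => e e0.
set q := complex.Re `|conjc k * k|.
have q0 : 0 <= q by rewrite -ler0c RRe_real ?ger0_real.
have [N hN] := hx _ (divr_gt0 e0 (ltr_wpDl q0 ltr01)).
exists N => m /hN + n => /(_ n) h.
rewrite (formZl (part_form _ _))// (formZr (part_form _ _))// scalerA nrmZ -/q.
rewrite (@le_trans _ _ ((q + 1) * nrm (part m n x x)))//.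
  by rewrite ler_wpM2r ?nrm_ge0// lerDl.
by rewrite mulrC -ler_pdivlMr// ltr_wpDl.
Qed.

Lemma part_ractr m n x y a : part m n x (ract y a) = part m n x y ** a.
Proof. by rewrite /part cmul_suml; apply: eq_bigr => i _; rewrite -cmulA. Qed.

Lemma part_ractl m n x y a : part m n (ract x a) y = star a ** part m n x y.
Proof.
by rewrite /part cmul_sumr; apply: eq_bigr => i _; rewrite cmulA -starM.
Qed.

Lemma elts_ract x a : @elts _ _ (l2 A) x -> @elts _ _ (l2 A) (ract x a).
Proof.
move=> /eltsP hx; apply/eltsP => e e0.
have q0 : 0 <= nrm a ^+ 2 by rewrite exprn_ge0 ?nrm_ge0.
have [N hN] := hx _ (divr_gt0 e0 (ltr_wpDl q0 ltr01)).
exists N => m /hN + n => /(_ n) h.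
rewrite part_ractl part_ractr (le_trans (nrmM _ _))// nrm_star.
rewrite (@le_trans _ _ ((nrm a ^+ 2 + 1) * nrm (part m n x x)))//.
  have := ler_wpM2l (nrm_ge0 a) (nrmM (part m n x x) a); have := nrm_ge0 (part m n x x).
  lra.
by rewrite mulrC -ler_pdivlMr// ltr_wpDl.
Qed.

Lemma inner_tends x y : @elts _ _ (l2 A) x -> @elts _ _ (l2 A) y ->
  tendsA (fun n => part 0 n x y) (inner x y).
Proof.
move=> /eltsP hx /eltsP hy.
have [|l _ ul] := banach_complete (banachA A) (u := fun n => part 0 n x y) (fun=> I).
  move=> e e0; have e4 : 0 < e / 4 by rewrite divr_gt0.
  have [N hN] := hx _ e4; have [M hM] := hy _ e4.
  exists (maxn N M).
  have hh m n : (m <= n)%N -> (maxn N M <= m)%N -> nrm (part 0 n x y - part 0 m x y) <= e.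
    move=> mn; rewrite geq_max => /andP[hm hm'].
    have h1 := hN _ hm n; have h2 := hM _ hm' n.
    rewrite (part_cat x y mn) [X in nrm X]addrC addKr.
    by have := @form_cauchy_sum _ _ _ _ _ (part_form m n) x y I I; lra.
  move=> m n Nm Nn; have [mn|/ltnW nm] := leqP m n; last exact: hh.
  by rewrite nrm_distC hh.
by rewrite (_ : inner x y = l)//; apply: cvg_lim => //; apply/tendsP.
Qed.

Lemma inner_form : positive_form (@elts _ _ (l2 A)) (@inner _ _ (l2 A)).
Proof.
split.
- exact: eltsD.
- exact: eltsZ.
- move=> x y z Ex Ey Ez; apply: (tends_unique (inner_tends (eltsD Ex Ey) Ez)).
  have := tendsD (inner_tends Ex Ez) (inner_tends Ey Ez).
  by congr tends; apply/funext => n; rewrite -(formDl (part_form _ _)).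
- move=> x y z Ex Ey Ez; apply: (tends_unique (inner_tends Ez (eltsD Ex Ey))).
  have := tendsD (inner_tends Ez Ex) (inner_tends Ez Ey).
  by congr tends; apply/funext => n; rewrite -(formDr (part_form _ _)).
- move=> k x y Ex Ey; apply: (tends_unique (inner_tends (eltsZ Ex) Ey)).
  have := @tends_lip (fun a => conjc k *: a) _ _ _ _ _ (inner_tends Ex Ey).
  move=> /(_ (complex.Re `|conjc k|)) h.
  have := h _ _; rewrite -ler0c RRe_real ?ger0_real// normr_ge0 => /(_ isT) {}h.
  have /h : forall a b : A, nrm (conjc k *: a - conjc k *: b) <= complex.Re `|conjc k| * nrm (a - b).
    by move=> a b; rewrite -scalerBr nrmZ.
  by congr tends; apply/funext => n; rewrite -(formZl (part_form _ _)).
- move=> k x y Ex Ey; apply: (tends_unique (inner_tends Ex (eltsZ Ey))).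
  have := @tends_lip (fun a => k *: a) _ _ _ _ _ (inner_tends Ex Ey).
  move=> /(_ (complex.Re `|k|)) h.
  have := h _ _; rewrite -ler0c RRe_real ?ger0_real// normr_ge0 => /(_ isT) {}h.
  have /h : forall a b : A, nrm (k *: a - k *: b) <= complex.Re `|k| * nrm (a - b).
    by move=> a b; rewrite -scalerBr nrmZ.
  by congr tends; apply/funext => n; rewrite -(formZr (part_form _ _)).
- move=> x Ex; apply: (@tends_pos _ _ 0%N) (inner_tends Ex Ex) => n _.
  by apply: (form_pos (part_form _ _)).
Qed.

Lemma inner_star x y : @elts _ _ (l2 A) x -> @elts _ _ (l2 A) y ->
  star (inner x y) = inner y x.
Proof.
move=> Ex Ey; apply: tends_unique (inner_tends Ey Ex).
have := @tends_lip (fun a => star a) 1 _ _ ler01 _ (inner_tends Ex Ey).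
have hs a b : nrm (star a - star b) <= 1 * nrm (a - b).
  by rewrite -starB nrm_star mul1r.
move=> /(_ hs); congr tends; apply/funext => n.
by rewrite /part star_sum; apply: eq_bigr => i _; rewrite starM starK.
Qed.

Lemma inner_ract x y a : @elts _ _ (l2 A) x -> @elts _ _ (l2 A) y ->
  inner x (ract y a) = inner x y ** a.
Proof.
move=> Ex Ey; apply: (tends_unique (inner_tends Ex (elts_ract Ey))).
have := tends_lip (nrm_ge0 a) (nrmMB_r a) (inner_tends Ex Ey).
by congr tends; apply/funext => n; rewrite part_ractr.
Qed.

Lemma part_inner_le x n : @elts _ _ (l2 A) x -> pos (inner x x - part 0 n x x).
Proof.
move=> Ex; have h := tendsD (inner_tends Ex Ex) (tends_const (- part 0 n x x)).
apply: (@tends_pos _ _ n _ h) => m /= nm.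
rewrite (part_cat x x nm) [X in pos X]addrC addKr.
by apply: (form_pos (part_form _ _)).
Qed.

Definition hn := form_norm (@inner _ _ (l2 A)).

Lemma hn_ge0 x : 0 <= hn x.
Proof. exact: form_norm_ge0. Qed.

Lemma hn_sqr x : hn x ^+ 2 = nrm (inner x x).
Proof. exact: form_norm_sqr. Qed.

Lemma hnorm_sqrt (V : hilbModData A) (x : V) :
  hnorm x = (Num.sqrt (nrm (inner x x)))%:C.
Proof.
rewrite /hnorm nrmE -{1}(sqr_sqrtr (nrm_ge0 (inner x x))) rmorphXn /= sqrCK//.
by rewrite ler0c sqrtr_ge0.
Qed.

Lemma hnormE x : hnorm x = (hn x)%:C.
Proof. exact: hnorm_sqrt. Qed.

Lemma nrm_coord_le x i : @elts _ _ (l2 A) x -> nrm (x i) <= hn x.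
Proof.
move=> Ex; rewrite -(@ler_pXn2r _ 2) ?nnegrE ?nrm_ge0 ?hn_ge0//.
rewrite hn_sqr -nrm_sq; apply: pos_le_nrm; first exact: pos_star_mul.
have := part_inner_le i.+1 Ex; rewrite /part big_nat_recr//= => h.
rewrite -(subrKA (star (x i) ** x i)).
have -> : inner x x - star (x i) ** x i =
  inner x x - (\sum_(0 <= j < i) star (x j) ** x j + star (x i) ** x i)
   + \sum_(0 <= j < i) star (x j) ** x j by lmodule R[i]; ring.
rewrite subrr addr0.
by apply: posD => //; apply: pos_sum => j _; apply: pos_star_mul.
Qed.

Lemma banach_l2 : banach (@elts _ _ (l2 A)) hn.
Proof.
have hf := inner_form; split.
- apply/eltsP => e e0; exists 0%N => m _ n; rewrite /part big1 ?nrm0 ?ltW// => i _.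
  exact: cmul0r.
- exact: eltsD.
- exact: eltsZ.
- exact: hn_ge0.
- exact: form_norm_triangle.
- move=> r x Ex; have Erx : elts (r%:C *: x) by apply: eltsZ.
  rewrite /hn /form_norm (formZl hf)// (formZr hf)//.
  rewrite conjc_real !nrmZr mulrA sqrtrM ?mulr_ge0// -expr2 sqrtr_sqr.
  by rewrite normr_id.
- move=> x Ex x0; apply/funext => i; apply: nrm_le0.
  by rewrite (le_trans (nrm_coord_le i Ex))// x0.
move=> u Eu hu.
have Euu m n : @elts _ _ (l2 A) (u m - u n).
  by rewrite -scaleN1r; apply/eltsD/eltsZ.
have /choice[l hl] : forall i, exists li, tendsA (fun n => u n i) li.
  move=> i; have [|li _ ul] := banach_complete (banachA A) (u := fun n => u n i) (fun=> I).
    move=> e e0; have [N hN] := hu _ e0; exists N => m n Nm Nn.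
    by apply: le_trans (hN _ _ Nm Nn); apply: (nrm_coord_le i (Euu m n)).
  by exists li.
have part_sqr x n : @elts _ _ (l2 A) x -> nrm (part 0 n x x) <= hn x ^+ 2.
  move=> Ex; rewrite hn_sqr; apply: pos_le_nrm (part_inner_le n Ex).
  by apply: (form_pos (part_form _ _)).
(* For fixed [k] only finitely many coordinates enter, so the Cauchy estimate on [u n - u m] passes
   to the limit in [m], with a bound that does not depend on [k]. *)
have key e : 0 < e -> exists N, forall n, (N <= n)%N -> forall k,
    nrm (part 0 k (u n - l) (u n - l)) <= e ^+ 2.
  move=> e0; have [N hN] := hu _ e0; exists N => n Nn k.
  have h : tendsA (fun m => part 0 k (u n - u m) (u n - u m)) (part 0 k (u n - l) (u n - l)).
    have hB i : tendsA (fun m => u n i - u m i) (u n i - l i).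
      move=> d /(hl i)[M hM]; exists M => m /hM.
      have -> : u n i - u m i - (u n i - l i) = l i - u m i by lmodule R[i]; ring.
      by rewrite nrm_distC.
    elim: k => [|k IH].
      by move=> d d0; exists 0%N => m _; rewrite /part !big_geq// subrr nrm0 ltW.
    rewrite [X in tendsA _ X]/part big_nat_recr//=.
    have hs : tendsA (fun m => star (u n k - u m k)) (star (u n k - l k)).
      apply: (tends_lip ler01 _ (hB k)) => a b.
      by rewrite -starB nrm_star mul1r.
    have := tendsD IH (tendsM hs (hB k)).
    by congr tends; apply/funext => m; rewrite [RHS]/part big_nat_recr.
  apply/ler_addgt0Pl => d d0; have [M hM] := h _ d0.
  have := hM _ (leq_maxl M N); rewrite nrm_distC => h1.
  rewrite -[part 0 k (u n - l) _](subrK (part 0 k (u n - u (maxn M N)) (u n - u (maxn M N)))).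
  rewrite (le_trans (nrmD _ _))// lerD// (le_trans (part_sqr _ _ (Euu _ _)))//.
  by rewrite ler_pXn2r ?nnegrE ?hn_ge0 ?(ltW e0)// hN// leq_maxr.
have El : @elts _ _ (l2 A) l.
  (* A tail of [l = u N - (u N - l)] is at most twice that of [u N] plus twice that of [u N - l];
     each is made at most [e / 4]. *)
  apply/eltsP => e e0; pose d := Num.sqrt (e / 4).
  have d0 : 0 < d by rewrite sqrtr_gt0 divr_gt0.
  have dd : d ^+ 2 = e / 4 by rewrite sqr_sqrtr// divr_ge0// ltW.
  have [N hN] := key _ d0; have /eltsP := Eu N.
  move=> /(_ (e / 4) (divr_gt0 e0 _)) -/(_ (ltr0Sn _ 3)) [M hM].
  exists M => m /hM + n => /(_ n) h1.
  have := @form_unit_le _ _ _ _ _ (part_form m n) (-1) (u N) (u N - l) I I.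
  rewrite conjcN1 mulrNN mulr1 => /(_ erefl).
  rewrite scaleN1r subKr; have := hN N (leqnn N) n; rewrite dd.
  have := part_le m n (u N - l); lra.
exists l => // e e0; have [N hN] := key _ e0; exists N => n /hN h.
have Eul : @elts _ _ (l2 A) (u n - l) by rewrite -scaleN1r; apply/eltsD/eltsZ.
rewrite -(@ler_pXn2r _ 2) ?nnegrE ?hn_ge0 ?(ltW e0)// hn_sqr.
apply/ler_addgt0Pl => d /(inner_tends Eul Eul)[M /(_ M (leqnn M))].
rewrite nrm_distC => h1; have h2 := h M.
rewrite -[inner _ _](subrK (part 0 M (u n - l) (u n - l))).
by rewrite (le_trans (nrmD _ _))// lerD.
Qed.

End L2.

(** * The open mapping theorem *)

Section OpenMapping.
Context (R : realType) (V : lmodType R[i]) (E : set V) (nm : V -> R).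
Hypothesis hE : banach E nm.

Let ED := banachD hE.
Let EZ := banachZ hE.
Let E0 := banach0 hE.

(** Baire's theorem: some [P k] is dense in a ball. Otherwise every ball contains one of at most
    half the radius that misses [P k], and the centres of the nested balls so chosen converge to a
    point of no [P k]. *)
Lemma baire_cover (P : nat -> set V) :
  (forall x, E x -> exists k, P k x) ->
  exists k x r, [/\ E x, 0 < r & forall y, E y -> nm (y - x) <= r ->
    forall e : R, 0 < e -> exists z, [/\ E z, P k z & nm (y - z) <= e]].
Proof.
move=> hP; apply: contrapT => hN.
pose good (k : nat) (p q : V * R) := [/\ E q.1, 0 < q.2, q.2 <= p.2 / 2,
  nm (q.1 - p.1) <= p.2 / 2 & forall z, E z -> nm (q.1 - z) <= q.2 -> ~ P k z].
have /choice[f hf] : forall kp : nat * (V * R), exists q,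
    E kp.2.1 -> 0 < kp.2.2 -> good kp.1 kp.2 q.
  move=> [k [x r]] /=; apply: contrapT => hq; apply: hN; exists k, x, (r / 2).
  have [Ex r0] : E x /\ 0 < r.
    by split; apply: contrapT => h; apply: hq; exists (x, r).
  have r2 : 0 < r / 2 by rewrite divr_gt0.
  split=> // y Ey yx e e0; apply: contrapT => hz; apply: hq.
  exists (y, Num.min e (r / 2)) => _ _; split=> //=; first by rewrite lt_min e0.
    by rewrite ge_min lexx orbT.
  move=> z Ez yz Pz; apply: hz; exists z; split=> //.
  by rewrite (le_trans yz)// ge_min lexx.
pose s := fix s k := if k is k'.+1 then f (k', s k') else (0, 1).
have hs k : E (s k).1 /\ 0 < (s k).2.
  by elim: k => [|k [Ek rk]] /=; [split | have [] := hf (k, s k) Ek rk].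
have gs k : good k (s k) (s k.+1) by have [Ek rk] := hs k; apply: (hf (k, s k)).
have Es k : E (s k).1 := (hs k).1.
have rs k : (s k).2 <= 2^-1 ^+ k.
  elim: k => [|k IH]; first by rewrite expr0.
  have [_ _ h _ _] := gs k; rewrite (le_trans h)// exprS mulrC.
  by rewrite ler_pM2l// invr_gt0.
have [||l El [ul _]] := @geometric_cvg _ _ _ _ hE (fun k => (s k).1) 2^-1 2^-1 _ Es.
- by rewrite invr_ge0 ler0n /= invf_lt1// ltr1n.
- move=> k; have [_ _ _ h _] := gs k; rewrite (le_trans h)// mulrC.
  by rewrite ler_pM2l ?invr_gt0.
have dist n j : nm ((s (n + j)%N).1 - (s n).1) <= (s n).2 - (s (n + j)%N).2.
  elim: j => [|j IH]; first by rewrite addn0 !subrr (nm0 hE).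
  have [_ _ h1 h2 _] := gs (n + j)%N; rewrite addnS.
  rewrite (le_trans (nm_triangle hE _ (Es (n + j)%N) _))//.
  lra.
have near n : nm ((s n).1 - l) <= (s n).2.
  apply/ler_addgt0Pl => e /ul[N le_N].
  rewrite (le_trans (nm_triangle hE _ (Es (n + N)%N) _))// addrC lerD//.
    by rewrite le_N// leq_addl.
  rewrite (nm_distC hE)// (le_trans (dist _ _))// gerBl.
  by have [_ /ltW] := hs (n + N)%N.
have [k Pk] := hP _ El.
by have [_ _ _ _ /(_ l El (near k.+1))] := gs k.
Qed.

(* Zabreiko's lemma for a relation: [Q x t] says that [x] can be attained at cost at most [t]; the last hypothesis is the countable subadditivity of the cost. *)
Lemma bounded_cost (Q : V -> R -> Prop) :
  (forall x, E x -> exists t, Q x t) ->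
  (forall x y s t, E x -> E y -> Q x s -> Q y t -> Q (x + y) (s + t)) ->
  (forall (c : R) x t, E x -> Q x t -> Q (c%:C *: x) (`|c| * t)) ->
  (forall x s t, E x -> Q x s -> s <= t -> Q x t) ->
  (forall (u : nat -> V) x t, (forall n, E (u n)) ->
     (forall n, Q (u n) (t * 2^-1 ^+ n)) -> E x ->
     tends nm (fun n => \sum_(0 <= i < n) u i) x -> Q x (2 * t)) ->
  exists2 C, 0 <= C & forall x, E x -> Q x (C * nm x).
Proof.
move=> Qex QD QZ Qle Qsum.
have [|k [x0 [r [Ex0 r0 hk]]]] := @baire_cover (fun k => [set x | Q x k%:R]).
  move=> x Ex; have [t Qt] := Qex _ Ex; exists (Num.bound `|t|) => /=.
  apply: (Qle _ t) => //; rewrite (le_trans (ler_norm t))//.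
  by rewrite ltW// archi_boundP.
(* The ball is moved from [x0] to the origin by writing [y] as half the difference of [x0 + y] and
   [x0 - y], which keeps the cost at [k]. *)
have step1 y e : E y -> nm y <= r -> 0 < e ->
    exists z, [/\ E z, Q z k%:R & nm (y - z) <= e].
  move=> Ey yr e0.
  have [|z1 [Ez1 Qz1 h1]] := hk (x0 + y) (ED Ex0 Ey) _ e e0; first by rewrite addrC addKr.
  have [|z2 [Ez2 Qz2 h2]] := hk (x0 - y) (banachB hE Ex0 Ey) _ e e0.
    by rewrite addrC addKr (nmN hE).
  have EN2 := banachN hE Ez2; have EB := ED Ez1 EN2.
  exists (2^-1%:C *: (z1 - z2)); split; first exact: EZ.
    have QN2 : Q (- z2) k%:R.
      by have := QZ (-1) _ _ Ez2 Qz2; rewrite normrN1 mul1r rmorphN1 scaleN1r.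
    have := QZ 2^-1 _ _ EB (QD _ _ _ _ Ez1 EN2 Qz1 QN2).
    rewrite (_ : `|2^-1| * _ = k%:R)// ger0_norm ?invr_ge0//; lra.
  have -> : y - 2^-1%:C *: (z1 - z2) =
      2^-1%:C *: ((x0 + y - z1) - (x0 - y - z2)).
    by rewrite half_real; lmodule R[i]; field.
  have Ea := banachB hE (ED Ex0 Ey) Ez1.
  have Eb := banachB hE (banachB hE Ex0 Ey) Ez2.
  rewrite (nmZ hE _ (banachB hE Ea Eb)) ger0_norm ?invr_ge0//.
  have := nmD hE Ea (banachN hE Eb); rewrite (nmN hE Eb); lra.
have half0 n : 0 < 2^-1 ^+ n :> R by rewrite exprn_gt0// invr_gt0.
have step2 n y : exists z, E y -> nm y <= r * 2^-1 ^+ n ->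
    [/\ E z, Q z (k%:R * 2^-1 ^+ n) & nm (y - z) <= r * 2^-1 ^+ n.+1].
  have [[Ey hy]|h] := pselect (E y /\ nm y <= r * 2^-1 ^+ n); last first.
    by exists 0 => Ey hy; case: h.
  pose c := (2^-1 ^+ n : R).
  have c0 : 0 < c := half0 n.
  have cC : c%:C != 0 :> R[i] by rewrite fmorph_eq0 gt_eqF.
  have Ecy := EZ c^-1%:C Ey.
  have [||z [Ez Qz hz]] := step1 _ (r / 2) Ecy.
  - rewrite (nmZ hE)// gtr0_norm ?invr_gt0// ler_pdivrMl// mulrC.
    exact: hy.
  - by rewrite divr_gt0.
  exists (c%:C *: z) => _ _; split; first exact: EZ.
    by have := QZ c _ _ Ez Qz; rewrite gtr0_norm// mulrC.
  have -> : y - c%:C *: z = c%:C *: (c^-1%:C *: y - z).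
    by rewrite fmorphV; lmodule R[i]; field.
  rewrite (nmZ hE _ (banachB hE Ecy Ez)) gtr0_norm// exprS -/c mulrA mulrC.
  by rewrite ler_pM2r.
have /choice[g hg] : forall p : nat * V, exists z, E p.2 -> nm p.2 <= r * 2^-1 ^+ p.1 ->
    [/\ E z, Q z (k%:R * 2^-1 ^+ p.1) & nm (p.2 - z) <= r * 2^-1 ^+ p.1.+1].
  by move=> [n y]; apply: step2.
have step3 y : E y -> nm y <= r -> Q y (2 * k%:R).
  move=> Ey yr.
  (* [w n] is what remains of [y] after [n] corrections. The bound on it halves each time and the
     correction costs [k 2^-n], for a total of [2 k]. *)
  pose w := fix w n := if n is n'.+1 then w n' - g (n', w n') else y.
  have hw n : E (w n) /\ nm (w n) <= r * 2^-1 ^+ n.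
    elim: n => [|n [En hn]] /=; first by rewrite expr0 mulr1.
    by have [Ez _ hz] := hg (n, w n) En hn; split=> //; apply: (banachB hE).
  have gw n := hg (n, w n) (hw n).1 (hw n).2.
  apply: (Qsum (fun n => g (n, w n))) => //.
  - by move=> n; have [] := gw n.
  - by move=> n; have [] := gw n.
  move=> e e0; have [|N le_N] := @geometric_small _ 2^-1 r e _ e0.
    by rewrite invr_ge0 ler0n /= invf_lt1// ltr1n.
  exists N => n /le_N h; apply: le_trans h.
  have -> : \sum_(0 <= i < n) g (i, w i) = y - w n.
    elim: n => [|n IH]; first by rewrite big_geq// subrr.
    by rewrite big_nat_recr//= IH opprB addrA addrAC.
  by rewrite addrC addKr (nmN hE) ?(hw n).2//; exact: (hw n).1.
exists (2 * k%:R / r); first by rewrite divr_ge0 ?mulr_ge0// ltW.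
move=> x Ex; have [x0'|xn0] := eqVneq (nm x) 0.
  have [t Qt] := Qex _ Ex; have := QZ 0 _ _ Ex Qt.
  by rewrite normr0 mul0r scale0r (nm_eq0 hE Ex x0') (nm0 hE) mulr0.
have xp : 0 < nm x by rewrite lt_neqAle eq_sym xn0 (nm_ge0 hE).
pose c := r / nm x; have c0 : 0 < c by rewrite divr_gt0.
have cC : c%:C != 0 :> R[i] by rewrite fmorph_eq0 gt_eqF.
have Ecx := EZ c%:C Ex.
have := step3 _ Ecx; rewrite (nmZ hE)// gtr0_norm// /c divfK// lexx => /(_ isT) Qy.
have := QZ c^-1 _ _ Ecx Qy.
rewrite scalerA -rmorphM /= -/c mulVf ?gt_eqF// rmorph1 scale1r gtr0_norm ?invr_gt0//.
rewrite (_ : c^-1 * _ = 2 * k%:R / r * nm x)// /c; field.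
by rewrite xn0 gt_eqF.
Qed.

End OpenMapping.

(** * Frames of finitely generated closed submodules *)

Section FormSums.
Context (R : realType) (A : cstarAlgType R).
Context (V : lmodType R[i]) (E : set V) (phi : V -> V -> A).
Hypothesis hphi : positive_form E phi.
Hypothesis E0 : E 0.

Lemma form_sum_closed (I : Type) (s : seq I) (x : I -> V) :
  (forall i, E (x i)) -> E (\sum_(i <- s) x i).
Proof. by move=> Ex; elim/big_ind: _ => // y z; apply: (formED hphi). Qed.

Lemma form_sumr (I : Type) (s : seq I) (x : I -> V) z : E z ->
  (forall i, E (x i)) -> phi z (\sum_(i <- s) x i) = \sum_(i <- s) phi z (x i).
Proof.
move=> Ez Ex; elim: s => [|i s IH].
  by rewrite !big_nil -(scale0r (0 : V)) (formZr hphi)// scale0r.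
by rewrite !big_cons (formDr hphi) ?IH//; apply: form_sum_closed.
Qed.

(** Each application of [form_add_le] at parameter 1 doubles the constant. *)
Lemma form_sum_le (I : Type) (s : seq I) (x : I -> V) : (forall i, E (x i)) ->
  pos ((2 ^+ size s)%:C *: (\sum_(i <- s) phi (x i) (x i))
       - phi (\sum_(i <- s) x i) (\sum_(i <- s) x i)).
Proof.
move=> Ex; elim: s => [|i s IH].
  rewrite !big_nil; have -> : phi 0 0 = 0.
    by rewrite -{2}(scale0r (0 : V)) (formZr hphi)// scale0r.
  by rewrite scaler0 subr0; apply: pos0.
rewrite !big_cons /=; have ES := form_sum_closed s Ex.
have h := form_add_le hphi (Ex i) ES ltr01.
set S := \sum_(j <- s) x j in h IH ES *; set T := \sum_(j <- s) _ in IH *.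
have h2 : 0 <= 2 ^+ size s - 1 :> R by rewrite subr_ge0 exprn_ege1// ler1n.
have h3 := posZ (addr_ge0 h2 h2) (form_pos hphi (Ex i)).
have h4 := posZ (ler0n R 2) IH.
move: (posD (posD h h3) h4); congr pos.
rewrite invr1 exprS; move: (2 ^+ size s) => q.
by lmodule R[i]; ring.
Qed.

End FormSums.

Section L2Modules.
Context (R : realType) (A : cstarAlgType R).
Implicit Types (a b c : A) (x y z : l2 A) (M N : set (l2 A)).

Local Notation "\1" := (cunit : A) : ring_scope.
Local Notation elts2 := (@elts _ _ (l2 A)).

Lemma ractDr x a b : ract x (a + b) = ract x a + ract x b.
Proof. by apply/funext => i; apply: cmulDr. Qed.

Lemma ractDl x y a : ract (x + y) a = ract x a + ract y a.
Proof. by apply/funext => i; apply: cmulDl. Qed.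

Lemma ractZr (k : R[i]) x a : ract x (k *: a) = k *: ract x a.
Proof. by apply/funext => i; apply: cmulZr. Qed.

Lemma ractM x a b : ract x (a ** b) = ract (ract x a) b.
Proof. by apply/funext => i; apply: cmulA. Qed.

Lemma ract1 x : ract x \1 = x.
Proof. by apply/funext => i; apply: cmul1r. Qed.

Lemma ractNl x a : ract (- x) a = - ract x a.
Proof. by apply/funext => i; apply: cmulNl. Qed.

Lemma ract_suml (I : Type) (s : seq I) (x : I -> l2 A) a :
  ract (\sum_(i <- s) x i) a = \sum_(i <- s) ract (x i) a.
Proof.
elim: s => [|i s IH]; first by rewrite !big_nil; apply/funext => j; apply: cmul0l.
by rewrite !big_cons ractDl IH.
Qed.

Lemma is_closedP M : is_closed M <-> nclosed elts2 (@hn _ A) M.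
Proof.
split=> h x Ex hx; apply: h => // e e0.
  have eE : (complex.Re e)%:C = e by rewrite RRe_real// gtr0_real.
  have e1 : 0 < complex.Re e / 2 by rewrite divr_gt0// -ltcR eE.
  have [y My xy] := hx _ e1; exists y => //.
  rewrite hnormE -eE ltcR (le_lt_trans xy)// ltr_pdivrMr// ltr_pMr ?ltr1n//.
  by rewrite -ltcR eE.
have ec0 : 0 < e%:C by rewrite -[0]/(0%:C) ltcR.
by have [y My xy] := hx _ ec0; exists y => //; move: xy; rewrite hnormE ltcR => /ltW.
Qed.

Lemma closed_submodule_banach M : closed_submodule M -> banach M (@hn _ A).
Proof.
move=> [[ME M0 MD MZ _] /is_closedP clM].
by apply: (banach_sub (banach_l2 A)).
Qed.

Lemma submodule_comb M n (h : 'I_n -> l2 A) (a : 'I_n -> A) : is_submodule M ->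
  (forall i, M (h i)) -> M (\sum_i ract (h i) (a i)).
Proof.
move=> [_ M0 MD _ Ma] Mh; elim/big_ind: _ => // i _; exact: Ma.
Qed.

(** The open mapping theorem for the surjection from [A^n] to [N]. Coefficients are not unique, so
    the cost of [y] is expressed as a relation: some choice of them is bounded by [t]. *)
Lemma fg_bounded_coef N n (h : 'I_n -> l2 A) : closed_submodule N ->
  (forall i, N (h i)) ->
  (forall y, N y -> exists a : 'I_n -> A, y = \sum_i ract (h i) (a i)) ->
  exists2 C : R, 0 <= C & forall y, N y -> exists a : 'I_n -> A,
    (forall i, nrm (a i) <= C * hn y) /\ y = \sum_i ract (h i) (a i).
Proof.
move=> clN Nh gen.
pose Q (y : l2 A) (t : R) := exists a : 'I_n -> A,
  (forall i, nrm (a i) <= t) /\ y = \sum_i ract (h i) (a i).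
have [NE N0 ND NZ _] := clN.1.
apply: (@bounded_cost _ _ _ _ (closed_submodule_banach clN) Q).
- move=> y /gen[a ->]; exists (\sum_i nrm (a i)); exists a; split=> // i.
  by rewrite (bigD1 i)//= lerDl sumr_ge0// => j _; apply: nrm_ge0.
- move=> x y s t _ _ [a [ha ->]] [b [hb ->]]; exists (fun i => a i + b i).
  split; first by move=> i; rewrite (le_trans (nrmD _ _))// lerD.
  by rewrite -big_split; apply: eq_bigr => i _; apply/esym/ractDr.
- move=> c y t _ [a [ha ->]]; exists (fun i => c%:C *: a i); split.
    by move=> i; rewrite nrmZr ler_wpM2l.
  by rewrite scaler_sumr; apply: eq_bigr => i _; rewrite ractZr.
- by move=> y s t _ [a [ha ->]] st; exists a; split=> // i; apply: le_trans st.
move=> u y t Nu Qu Ny uy; have /choice[a ha] := Qu.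
have half1 : 0 <= (2^-1 : R) < 1.
  by apply/andP; split; [rewrite invr_ge0|rewrite invf_lt1// ltr1n].
pose S i m := \sum_(0 <= k < m) a k i.
have /choice[b hb] : forall i, exists l, tends (@nrm _ A) (S i) l /\ nrm l <= 2 * t.
  move=> i; have [||l _ [Sl hl]] := @geometric_cvg _ _ _ _ (banachA A) (S i) t _ half1.
  - by [].
  - move=> m; rewrite /S big_nat_recr//= [X in nrm X]addrC addKr.
    by have [] := ha m.
  exists l; split=> //; have := hl 0%N; rewrite /S big_geq// sub0r nrmN expr0 mulr1.
  have h12 : 1 - 2^-1 = 2^-1 :> R by field.
  by rewrite h12 invrK mulrC.
exists b; split=> [i|]; first exact: (hb i).2.
apply/funext => j.
(* The expansion of [y] is checked one coordinate at a time: coordinates are continuous, and both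
   sides are limits of the same sequence in [A]. *)
have hl : tends (@nrm _ A) (fun m => (\sum_(0 <= k < m) u k) j) (y j).
  move=> e /uy[K hK]; exists K => m /hK; apply: le_trans.
  apply: (@nrm_coord_le _ _ (\sum_(0 <= k < m) u k - y)).
  apply: (banachB (banach_l2 A)); last exact: NE.
  by apply: (form_sum_closed (inner_form A)) => [|k]; apply: NE.
apply: (tends_unique hl).
have sumE (F : 'I_n -> l2 A) : (\sum_i F i) j = \sum_i F i j.
  by elim/big_rec2: _ => [//|i v w _ <-].
have -> : (fun m => (\sum_(0 <= k < m) u k) j) =
    (fun m => \sum_i h i j ** S i m).
  apply/funext => m; rewrite /S; elim: m => [|m IH].
    by rewrite big_geq// big1// => i _; rewrite big_geq// cmul0r.
  rewrite big_nat_recr//= -[LHS]/((\sum_(0 <= k < m) u k) j + u m j) IH.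
  rewrite (ha m).2 sumE -big_split; apply: eq_bigr => i _ /=.
  by rewrite big_nat_recr//= cmulDr.
rewrite sumE; elim: (index_enum _) => [|i s IH].
  by move=> e e0; exists 0%N => m _; rewrite !big_nil subrr nrm0 ltW.
rewrite big_cons; have := tendsD (tends_lip (nrm_ge0 _) (nrmMB_l (h i j)) (hb i).1) IH.
by congr tends; apply/funext => m; rewrite big_cons.
Qed.

Lemma sqrt_inv_pair (p : A) (e : R) : pos p -> 0 < e -> exists r v,
  [/\ star r = r, star v = v, r ** v = \1, v ** r = \1 & r ** r = p + e%:C *: \1].
Proof.
move=> pp e0; have [r [sr rr cr]] := pos_sqrt pp e0.
have [q [sq q1 q2 cq]] := pos_inv pp e0.
have rq : r ** q = q ** r by apply/cq/esym/cr.
exists r, (q ** r); split=> //.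
- by rewrite starM sr sq.
- by rewrite cmulA rq -cmulA rr.
- by rewrite -cmulA rr.
Qed.

(** Let [y'] be [y] normalised to have norm at most 1, with coefficients [a_i] bounded by [C]. Then
    [<y', y'>] is the sum of the [star <h_i, y'> ** a_i], and completing the square separates the
    inner products from the bounded [a_i]; undoing the normalisation turns the estimate into an
    inequality in [A]. *)
Lemma fg_lower_bound N n (h : 'I_n -> l2 A) : closed_submodule N ->
  (forall i, N (h i)) ->
  (forall y, N y -> exists a : 'I_n -> A, y = \sum_i ract (h i) (a i)) ->
  exists2 K : R, 1 <= K & forall y, N y ->
    pos (K%:C *: (\sum_i star (inner (h i) y) ** inner (h i) y) - inner y y).
Proof.
move=> clN Nh gen; have [C C0 hC] := fg_bounded_coef clN Nh gen.
have [NE N0 ND NZ Na] := clN.1; have hf := inner_form A.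
pose K := n%:R * C ^+ 2 + 1.
have K1 : 1 <= K by rewrite /K lerDr mulr_ge0// exprn_ge0.
have K0 : 0 < K := lt_le_trans ltr01 K1.
have KC : K%:C != 0 :> R[i] by rewrite fmorph_eq0 gt_eqF.
exists K => // y Ny; have Ey := NE _ Ny.
apply: pos_eps => e e0.
have [p pE] : exists p, p = inner y y by exists (inner y y).
have pp : pos p by rewrite pE; apply: (form_pos hf).
rewrite -pE.
have [r [v [sr sv rv vr rr]]] := sqrt_inv_pair pp e0.
(* Since [v] is an inverse square root of [p + e], [<y', y'> = v p v = 1 - e v^2], which is at most
   1. *)
pose y' := ract y v; have Ny' : N y' by apply: Na.
have Ey' := NE _ Ny'.
have yy' : inner y' y' = v ** p ** v.
  by rewrite inner_ract// -(inner_star Ey Ey') inner_ract// starM sv (inner_star Ey Ey) -pE.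
have hn1 : hn y' <= 1.
  rewrite -(@ler_pXn2r _ 2) ?nnegrE ?hn_ge0// hn_sqr expr1n.
  apply: pos_nrm; [exact: form_pos hf _ Ey'| |exact: ler01].
  have := posZ (ltW e0) (pos_sqr sv); congr pos; rewrite yy'.
  have -> : p = r ** r - e%:C *: \1 by rewrite rr addrK.
  expand_products; rewrite vr cmul1l rv rmorph1.
  by lmodule R[i]; ring.
have [a [ha ya]] := hC _ Ny'.
have ha1 i : nrm (a i) <= C by rewrite (le_trans (ha i))// ler_piMr.
pose c i := inner (h i) y.
have cy' i : inner (h i) y' = c i ** v by rewrite inner_ract//; apply: NE.
have e1 : inner y' y' = \sum_i star (c i ** v) ** a i.
  rewrite {2}ya (form_sumr hf) => //; last first.
  - by move=> i; apply/NE/Na.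
  - exact: banach0 (banach_l2 A).
  apply: eq_bigr => i _; have Ehi := NE _ (Nh i).
  by rewrite inner_ract// -(inner_star Ehi Ey') cy'.
have e2 : inner y' y' = \sum_i star (a i) ** (c i ** v).
  rewrite -(inner_star Ey' Ey') e1 star_sum; apply: eq_bigr => i _.
  by rewrite starM starK.
(* With [d = c i ** v], the summand is [K^-1] times the square of [K d - a i]. As [K >= n C^2], the
   terms in [a i] add up to at most 1, leaving [2 <y', y'> <= K \sum_i star d ** d + 1]. *)
have h1 : pos (\sum_i (K%:C *: (star (c i ** v) ** (c i ** v)) +
    K^-1%:C *: (star (a i) ** a i) - star (c i ** v) ** a i - star (a i) ** (c i ** v))).
  apply: pos_sum => i _; move: (c i ** v) => d.
  have := posZ (ltW (_ : 0 < K^-1)) (pos_star_mul (K%:C *: d - a i)).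
  rewrite invr_gt0 => /(_ K0); congr pos.
  rewrite starB starZr fmorphV; expand_products; lmodule R[i]; field => //.
have h2 : pos (\sum_(i < n) (K^-1%:C *: ((C ^+ 2)%:C *: \1 - star (a i) ** a i))).
  apply: pos_sum => i _; apply: posZ; first by rewrite invr_ge0 ltW.
  apply: pos_nrmB; first by rewrite starM starK.
  by rewrite nrm_sq ler_pXn2r ?nnegrE ?nrm_ge0.
have h3 : 0 <= 1 - n%:R * (K^-1 * C ^+ 2).
  rewrite subr_ge0 mulrCA mulrC ler_pdivrMr// mul1r /K lerDl ler01.
  by [].
have h1' : pos (K%:C *: (\sum_i star (c i ** v) ** (c i ** v))
    + K^-1%:C *: (\sum_i star (a i) ** a i)
    - \sum_i star (c i ** v) ** a i - \sum_i star (a i) ** (c i ** v)).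
  by move: h1; rewrite !big_split /= !sumrN -!scaler_sumr.
have h2' : pos (K^-1%:C *: (n%:R *: ((C ^+ 2)%:C *: \1) - \sum_i star (a i) ** a i)).
  move: h2; rewrite -scaler_sumr big_split /= sumrN sumr_const card_ord.
  by rewrite -scaler_nat.
have h4 := posD (posD h1' h2') (pos_scalar A h3).
have h5 : pos (K%:C *: (\sum_i star (c i ** v) ** (c i ** v)) + \1
    - inner y' y' - inner y' y').
  move: h4; congr pos; rewrite {1}e1 e2.
  rewrite !rmorphB !rmorphM rmorph1 rmorph_nat /=.
  by lmodule R[i]; ring.
(* Conjugation by [r] sends [<y', y'>] back to [p] and 1 to [p + e]; one of the two copies of [p]
   cancels, and only the error [e] remains. *)
have := pos_conj r h5; rewrite yy' sr; congr pos.
have cr i : c i ** v ** r = c i by rewrite -cmulA vr cmul1r.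
have -> : \sum_i star (c i) ** c i = r ** (\sum_i star (c i ** v) ** (c i ** v)) ** r.
  rewrite cmul_sumr cmul_suml; apply: eq_bigr => i _.
  by rewrite -{1 2}(cr i) starM sr !cmulA.
have e3 : r ** (v ** p ** v) ** r = p.
  by rewrite !cmulA rv cmul1l -cmulA vr cmul1r.
move: e3 rr; set q := v ** p ** v; set w := \sum_i _ => e3 rr.
clearbody q w; rewrite !(cmulDr, cmulDl, cmulNr, cmulNl, cmulZr, cmulZl) cmul1r e3 rr.
by lmodule R[i]; ring.
Qed.

End L2Modules.

Section Frames.
Context (R : realType) (A : cstarAlgType R).
Implicit Types (a b c : A) (x y z : l2 A) (M N : set (l2 A)).

Local Notation "\1" := (cunit : A) : ring_scope.
Local Notation elts2 := (@elts _ _ (l2 A)).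

Lemma fg_upper_bound n (h : 'I_n -> l2 A) : (forall i, elts2 (h i)) ->
  exists2 s : R, 1 <= s & forall a : 'I_n -> A,
    pos (s%:C *: (\sum_i star (a i) ** a i)
      - inner (\sum_i ract (h i) (a i)) (\sum_i ract (h i) (a i))).
Proof.
move=> Eh; have hf := inner_form A.
pose H := \sum_i nrm (inner (h i) (h i)).
have H0 : 0 <= H by apply: sumr_ge0 => i _; apply: nrm_ge0.
pose q : R := 2 ^+ size (index_enum 'I_n).
have q0 : 0 <= q by rewrite exprn_ge0.
exists (q * H + 1); first by rewrite lerDr mulr_ge0.
move=> a; have Eha i : elts2 (ract (h i) (a i)) by apply: elts_ract.
have h1 : pos (q%:C *: (\sum_i inner (ract (h i) (a i)) (ract (h i) (a i)))
    - inner (\sum_i ract (h i) (a i)) (\sum_i ract (h i) (a i))).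
  exact (form_sum_le hf (banach0 (banach_l2 A)) (index_enum 'I_n) Eha).
have h2 : pos (\sum_i (H%:C *: (star (a i) ** a i)
    - inner (ract (h i) (a i)) (ract (h i) (a i)))).
  apply: pos_sum => i _.
  rewrite inner_ract// -(inner_star (Eh i) (Eha i)) inner_ract// starM (inner_star (Eh i))//.
  apply: pos_conj_le; first exact: inner_star.
  by rewrite /H (bigD1 i)//= lerDl sumr_ge0// => j _; apply: nrm_ge0.
have h2' : pos (H%:C *: (\sum_i star (a i) ** a i)
    - \sum_i inner (ract (h i) (a i)) (ract (h i) (a i))).
  by move: h2; rewrite big_split /= sumrN -scaler_sumr.
have h3 : pos (\sum_i star (a i) ** a i) by apply: pos_sum => i _; apply: pos_star_mul.
have := posD (posD (posZ q0 h2') h1) h3; congr pos.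
have -> : (q * H + 1)%:C = q%:C * H%:C + 1 :> R[i] by rewrite rmorphD rmorphM rmorph1.
by lmodule R[i]; ring.
Qed.

(* The frame operator [B y = \sum_i h_i <h_i, y>] is bounded above and below on [N], so [1 - B / s] is a contraction there and [B] is onto. *)
Lemma fg_frame N n (h : 'I_n -> l2 A) : closed_submodule N ->
  (forall i, N (h i)) ->
  (forall y, N y -> exists a : 'I_n -> A, y = \sum_i ract (h i) (a i)) ->
  exists w : 'I_n -> l2 A, (forall i, elts2 (w i)) /\
    forall y, N y -> y = \sum_i ract (h i) (inner (w i) y).
Proof.
move=> clN Nh gen; have hf := inner_form A.
have hN := closed_submodule_banach clN.
have [NE N0 ND NZ Na] := clN.1.
have [K K1 hK] := fg_lower_bound clN Nh gen.
have [s s1 hs] := fg_upper_bound (fun i => NE _ (Nh i)).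
have K0 : 0 < K := lt_le_trans ltr01 K1.
have s0 : 0 < s := lt_le_trans ltr01 s1.
have E0 := banach0 (banach_l2 A).
pose B (y : l2 A) : l2 A := \sum_i ract (h i) (inner (h i) y).
pose tau (y : l2 A) := \sum_i star (inner (h i) y) ** inner (h i) y.
have NB y : N (B y) by apply: submodule_comb clN.1 Nh.
have EB y : elts2 (B y) by apply: NE.
have innerB z y : N z -> N y -> inner z (B y) = \sum_i star (inner (h i) z) ** inner (h i) y.
  move=> Nz Ny; have Ez := NE _ Nz.
  rewrite (form_sumr hf) => //; last by move=> i; apply/NE/Na.
  apply: eq_bigr => i _; have Ehi := NE _ (Nh i).
  by rewrite inner_ract// -(inner_star Ehi Ez).
have BD y z : N y -> N z -> B (y - z) = B y - B z.
  move=> Ny Nz; rewrite /B -sumrN -big_split; apply: eq_bigr => i _.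
  have [Ey Ez Eh] := And3 (NE _ Ny) (NE _ Nz) (NE _ (Nh i)).
  rewrite -scaleN1r (formDr hf) ?(formZr hf)//; last exact: eltsZ.
  by rewrite ractDr ractZr scaleN1r.
pose rho := Num.sqrt (1 - (s * K)^-1).
have sK1 : 1 <= s * K by rewrite (le_trans s1)// ler_peMr// ltW.
have rho2 : rho ^+ 2 = 1 - (s * K)^-1.
  by rewrite sqr_sqrtr// subr_ge0 invf_le1// mulr_gt0.
have rho0 : 0 <= rho by exact: sqrtr_ge0.
have rho1 : rho < 1.
  rewrite -(@ltr_pXn2r _ 2) ?nnegrE// rho2 expr1n ltrBlDl ltrDr invr_gt0.
  by rewrite mulr_gt0.
have contr y : N y -> hn (y - s^-1%:C *: B y) <= rho * hn y.
  move=> Ny; have Ey := NE _ Ny.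
  rewrite -(@ler_pXn2r _ 2) ?nnegrE ?mulr_ge0 ?hn_ge0// exprMn rho2 !hn_sqr.
  rewrite -[1 - _]ger0_norm ?subr_ge0 ?invf_le1 ?mulr_gt0// -nrmZr.
  apply: pos_le_nrm.
    by apply: (form_pos hf); rewrite -scaleNr; apply/eltsD/eltsZ.
  (* [<y, y> - (2 / s) tau + s^-2 <B y, B y>] is at most [<y, y> - tau / s] by the upper bound,
     hence at most [(1 - 1 / (s K)) <y, y>] by the lower one. *)
  have h1 := hK _ Ny; have h2 := hs (fun i => inner (h i) y).
  have sV : 0 <= s^-1 by rewrite invr_ge0 ltW.
  have KV : 0 <= K^-1 by rewrite invr_ge0 ltW.
  have := posD (posZ sV (posZ KV h1)) (posZ sV (posZ sV h2)); congr pos.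
  have := form_lin2 hf 1 (- s^-1%:C) Ey (EB y); rewrite !scale1r scaleNr => ->.
  have tE : inner y (B y) = tau y by apply: innerB.
  have st : star (tau y) = tau y.
    by rewrite /tau star_sum; apply: eq_bigr => i _; rewrite starM starK.
  have tE' : inner (B y) y = tau y by rewrite -(inner_star Ey (EB y)) tE st.
  rewrite tE tE' -/(tau y) -/(B y) conjc1 -rmorphN conjc_real.
  rewrite rmorphN rmorphB rmorph1 invfM rmorphM !fmorphV /=.
  have s0' : s%:C != 0 :> R[i] by rewrite fmorph_eq0 gt_eqF.
  have K0' : K%:C != 0 :> R[i] by rewrite fmorph_eq0 gt_eqF.
  by lmodule R[i]; field; rewrite ?s0' ?K0'.
have onto x : N x -> exists u, N u /\ B u = x.
  move=> Nx; pose f (u : l2 A) := u - s^-1%:C *: (B u - x).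
  have NBx u : N (B u - x) by apply: (banachB hN).
  have fN u : N u -> N (f u) by move=> Nu; apply: (banachB hN) => //; apply: NZ.
  have [||||||u Nu fu] := @contraction _ _ _ _ hN N f rho 0.
  - by [].
  - by move=> y Ny /(_ 1 ltr01) [z Nz _].
  - by [].
  - exact: fN.
  - by rewrite rho0.
  - move=> y z Ny Nz; have Nyz := banachB hN Ny Nz.
    have -> : f y - f z = (y - z) - s^-1%:C *: B (y - z).
      by rewrite /f BD//; lmodule R[i]; ring.
    exact: contr.
  exists u; split=> //; apply/subr0_eq.
  have s0' : s%:C != 0 :> R[i] by rewrite fmorph_eq0 gt_eqF.
  have : s^-1%:C *: (B u - x) = 0.
    by rewrite -[LHS](subKr u) -/(f u) fu subrr.
  by move=> /eqP; rewrite scaler_eq0 fmorph_eq0 invr_eq0 gt_eqF//= => /eqP.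
have /choice[w hw] : forall i, exists u, N u /\ B u = h i by move=> i; apply: onto.
exists w; split=> [i|y Ny]; first by apply: NE; apply: (hw i).1.
have [u [Nu <-]] := onto _ Ny; rewrite {1}/B; apply: eq_bigr => i _.
have [Nw Bw] := hw i; congr ract.
(* With [y = B u], self-adjointness of [B] turns [<h_i, u> = <B w_i, u>] into [<w_i, y>]. *)
rewrite innerB// -{1}Bw -(inner_star (NE _ Nu) (EB _)) innerB// star_sum.
by apply: eq_bigr => j _; rewrite starM starK.
Qed.

End Frames.

(** * Bounded operators on l2(A) *)

Section Operators.
Context (R : realType) (A : cstarAlgType R).
Implicit Types (x y z : l2 A) (M N E : set (l2 A)) (F G S T : l2 A -> l2 A).

Local Notation elts2 := (@elts _ _ (l2 A)).
Local Notation hnA := (@hn _ A).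

Section ClosedRelations.
Variables (E M : set (l2 A)) (Q : l2 A -> l2 A -> Prop).
Hypotheses (clE : closed_submodule E) (clM : closed_submodule M).
Hypothesis QD : forall x y m n, E x -> E y -> M m -> M n ->
  Q x m -> Q y n -> Q (x + y) (m + n).
Hypothesis QZ : forall (k : R[i]) x m, E x -> M m -> Q x m -> Q (k *: x) (k *: m).
Hypothesis Qcl : forall x m, E x -> M m ->
  (forall e : R, 0 < e -> exists y n, [/\ E y, M n, Q y n, hn (x - y) <= e & hn (m - n) <= e]) ->
  Q x m.
Hypothesis Qtotal : forall x, E x -> exists2 m, M m & Q x m.

(** The cost of [x] is the norm of some [m] related to it; [Qcl] makes the relation survive
    summation of the series of such [m]. *)
Lemma closed_relation_bound : exists2 C, 0 <= C & forall x, E x ->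
  exists m, [/\ M m, Q x m & hn m <= C * hn x].
Proof.
have hE := closed_submodule_banach clE; have hM := closed_submodule_banach clM.
apply: (@bounded_cost _ _ _ _ hE (fun x t => exists m, [/\ M m, Q x m & hn m <= t])).
- by move=> x /Qtotal[m Mm Qm]; exists (hn m), m.
- move=> x y s t Ex Ey [m [Mm Qm hm]] [n [Nn Qn hn']]; exists (m + n).
  split; [exact: (banachD hM)|exact: QD|].
  by rewrite (le_trans (nmD hM Mm Nn))// lerD.
- move=> c x t Ex [m [Mm Qm hm]]; exists (c%:C *: m).
  by split; [exact: (banachZ hM)|exact: QZ|rewrite (nmZ hM _ Mm) ler_wpM2l].
- by move=> x s t Ex [m [Mm Qm hm]] st; exists m; split=> //; apply: le_trans st.
move=> u x t Eu /choice[m hm] Ex ux.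
have half1 : 0 <= (2^-1 : R) < 1.
  by apply/andP; split; [rewrite invr_ge0|rewrite invf_lt1// ltr1n].
pose S n : l2 A := \sum_(0 <= k < n) m k.
pose U n : l2 A := \sum_(0 <= k < n) u k.
have SUQ n : [/\ M (S n), E (U n) & Q (U n) (S n)].
  rewrite /S /U; elim: n => [|n [IM IE IQ]].
    rewrite !big_geq//; split; [exact: banach0 hM|exact: banach0 hE|].
    have [m0 Mm0 Q0] := Qtotal (banach0 hE).
    by have := QZ 0 (banach0 hE) Mm0 Q0; rewrite !scale0r.
  rewrite !big_nat_recr//=; have [Mm Qm _] := hm n.
  by split; [exact: (banachD hM)|exact: (banachD hE)|exact: QD].
have MS n : M (S n) by have [] := SUQ n.
have [||l Ml [Sl hl]] := @geometric_cvg _ _ _ _ hM S t _ half1.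
- exact: MS.
- move=> n; rewrite /S big_nat_recr//= [X in hnA X]addrC addKr.
  by have [] := hm n.
exists l; split=> //.
  apply: Qcl => // e e0; have [N1 h1] := ux _ e0; have [N2 h2] := Sl _ e0.
  pose K := maxn N1 N2; exists (U K), (S K); have [MK EK QK] := SUQ K.
  split=> //; first by rewrite (nm_distC hE)// h1// leq_maxl.
  by rewrite (nm_distC hM)// h2// leq_maxr.
have := hl 0%N; rewrite /S big_geq// sub0r (nmN hM)// expr0 mulr1.
have h12 : 1 - 2^-1 = 2^-1 :> R by field.
by rewrite h12 invrK mulrC.
Qed.

Hypothesis Qa : forall x m (a : A), E x -> M m -> Q x m -> Q (ract x a) (ract m a).
Hypothesis Qfun : forall x m n, E x -> M m -> M n -> Q x m -> Q x n -> m = n.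

(** A closed graph theorem. It yields the projection of a direct decomposition, from the relation
    [N (x - m)], and the inverse of an isomorphism, from its reversed graph. *)
Lemma closed_relation_operator : exists S,
  (forall x, E x -> M (S x) /\ Q x (S x)) /\ bounded_Alinear E M S.
Proof.
have [C C0 hC] := closed_relation_bound.
have [_ _ ED EZ Ea] := clE.1; have [_ _ MD MZ Ma] := clM.1.
have /choice[S hS] : forall x, exists m, E x -> [/\ M m, Q x m & hn m <= C * hn x].
  move=> x; have [Ex|nEx] := pselect (E x); last by exists 0.
  by have [m hm] := hC _ Ex; exists m.
have SM x : E x -> M (S x) by move=> /hS[].
have SQ x : E x -> Q x (S x) by move=> /hS[].
exists S; split=> [x Ex|]; first by split; [exact: SM|exact: SQ].
split=> //.
- move=> x y Ex Ey; apply: (Qfun (ED _ _ Ex Ey)).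
  + exact/SM/ED.
  + by apply: MD; apply: SM.
  + exact/SQ/ED.
  + by apply: QD; [| |exact: SM|exact: SM|exact: SQ|exact: SQ].
- move=> k x Ex; apply: (Qfun (EZ k _ Ex)).
  + exact/SM/EZ.
  + exact/MZ/SM.
  + exact/SQ/EZ.
  + by apply: QZ; [|exact: SM|exact: SQ].
- move=> x a Ex; apply: (Qfun (Ea _ a Ex)).
  + exact/SM/Ea.
  + exact/Ma/SM.
  + exact/SQ/Ea.
  + by apply: Qa; [|exact: SM|exact: SQ].
exists C%:C => x /hS[_ _ h].
by rewrite !hnormE -rmorphM lecR.
Qed.
End ClosedRelations.

(** The constant in [bounded_Alinear] is an arbitrary element of [R[i]]; comparing real parts shows
    that the absolute value of its real part is also a bound. *)
Lemma bounded_real M N F : bounded_Alinear M N F ->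
  exists2 k : R, 0 <= k & forall x, M x -> hn (F x) <= k * hn x.
Proof.
move=> [_ _ _ _ [k hk]]; exists `|complex.Re k| => // x /hk.
rewrite !hnormE lecE => /andP[_] /=; case: k {hk} => k1 k2 /=.
by rewrite mulr0 subr0 => h; rewrite (le_trans h)// ler_wpM2r ?hn_ge0// ler_norm.
Qed.

Lemma closed_elts : closed_submodule elts2.
Proof.
split; last by move=> x.
split=> //; [exact: banach0 (banach_l2 A)|exact: eltsD|move=> c x; exact: eltsZ|].
by move=> x a; apply: elts_ract.
Qed.

Lemma closed_submoduleB M x y : closed_submodule M -> M x -> M y -> M (x - y).
Proof. by move=> /closed_submodule_banach hM; apply: (banachB hM). Qed.

Section BoundedOperators.
Variables (F : l2 A -> l2 A).
Hypothesis hF : bounded_operator F.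

Lemma bopE x : elts2 x -> elts2 (F x).
Proof. by have [h _ _ _ _] := hF; apply: h. Qed.

Lemma bopD x y : elts2 x -> elts2 y -> F (x + y) = F x + F y.
Proof. by have [_ h _ _ _] := hF; apply: h. Qed.

Lemma bopZ (k : R[i]) x : elts2 x -> F (k *: x) = k *: F x.
Proof. by have [_ _ h _ _] := hF; apply: h. Qed.

Lemma bopa x (a : A) : elts2 x -> F (ract x a) = ract (F x) a.
Proof. by have [_ _ _ h _] := hF; apply: h. Qed.

Lemma bop0 : F 0 = 0.
Proof. by rewrite -[X in F X](scale0r (0 : l2 A)) bopZ ?scale0r//; exact: banach0 (banach_l2 A). Qed.

Lemma bopB x y : elts2 x -> elts2 y -> F (x - y) = F x - F y.
Proof.
by move=> Ex Ey; rewrite -scaleN1r bopD ?bopZ ?scaleN1r//; apply: (banachN (banach_l2 A)).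
Qed.

Lemma bop_sum n (g : 'I_n -> l2 A) (a : 'I_n -> A) : (forall i, elts2 (g i)) ->
  F (\sum_i ract (g i) (a i)) = \sum_i ract (F (g i)) (a i).
Proof.
move=> Eg; pose P x y := elts2 x /\ F x = y.
suff [] : P (\sum_i ract (g i) (a i)) (\sum_i ract (F (g i)) (a i)) by [].
elim/big_ind2: _ => [|x1 x2 y1 y2 [Ex <-] [Ey <-]|i _].
- by split; [exact: banach0 (banach_l2 A)|exact: bop0].
- by split; [exact: eltsD|rewrite bopD].
- by split; [exact: elts_ract|rewrite bopa].
Qed.

Lemma bop_bound : exists2 k : R, 0 <= k & forall x, elts2 x -> hn (F x) <= k * hn x.
Proof. exact: bounded_real hF. Qed.

End BoundedOperators.

Lemma bounded_operatorI F (k : R) : (forall x, elts2 x -> elts2 (F x)) ->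
  (forall x y, elts2 x -> elts2 y -> F (x + y) = F x + F y) ->
  (forall (c : R[i]) x, elts2 x -> F (c *: x) = c *: F x) ->
  (forall x (a : A), elts2 x -> F (ract x a) = ract (F x) a) ->
  (forall x, elts2 x -> hn (F x) <= k * hn x) -> bounded_operator F.
Proof.
move=> h1 h2 h3 h4 h5; split=> //; exists k%:C => x Ex.
by rewrite !hnormE -rmorphM lecR h5.
Qed.

Lemma bop_id : bounded_operator (fun x : l2 A => x).
Proof. by apply: (@bounded_operatorI _ 1) => // x _; rewrite mul1r. Qed.

Lemma bop_comp F G : bounded_operator F -> bounded_operator G ->
  bounded_operator (fun x => G (F x)).
Proof.
move=> hF hG; have [k k0 hk] := bop_bound hF; have [l l0 hl] := bop_bound hG.
have EF := bopE hF; have EG := bopE hG.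
apply: (@bounded_operatorI _ (l * k)).
- by move=> x /EF/EG.
- by move=> x y Ex Ey; rewrite (bopD hF)// (bopD hG)//; apply: EF.
- by move=> c x Ex; rewrite (bopZ hF)// (bopZ hG)//; apply: EF.
- by move=> x a Ex; rewrite (bopa hF)// (bopa hG)//; apply: EF.
- by move=> x Ex; rewrite (le_trans (hl _ (EF _ Ex)))// -mulrA ler_wpM2l// hk.
Qed.

Lemma bop_add F G : bounded_operator F -> bounded_operator G ->
  bounded_operator (fun x => F x + G x).
Proof.
move=> hF hG; have [k k0 hk] := bop_bound hF; have [l l0 hl] := bop_bound hG.
have EF := bopE hF; have EG := bopE hG.
apply: (@bounded_operatorI _ (k + l)).
- by move=> x Ex; apply: eltsD; [exact: EF|exact: EG].
- by move=> x y Ex Ey; rewrite (bopD hF)// (bopD hG)// addrACA.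
- by move=> c x Ex; rewrite (bopZ hF)// (bopZ hG)// scalerDr.
- by move=> x a Ex; rewrite (bopa hF)// (bopa hG)// ractDl.
- move=> x Ex; rewrite (le_trans (nmD (banach_l2 A) (EF _ Ex) (EG _ Ex)))// mulrDl.
  by rewrite lerD ?hk ?hl.
Qed.

Lemma bop_sub F G : bounded_operator F -> bounded_operator G ->
  bounded_operator (fun x => F x - G x).
Proof.
move=> hF hG; have [k k0 hk] := bop_bound hF; have [l l0 hl] := bop_bound hG.
have EF := bopE hF; have EG := bopE hG.
have ENG x : elts2 x -> elts2 (- G x) by move=> Ex; apply/(banachN (banach_l2 A))/EG.
apply: (@bounded_operatorI _ (k + l)).
- by move=> x Ex; apply: eltsD; [exact: EF|exact: ENG].
- by move=> x y Ex Ey; rewrite (bopD hF)// (bopD hG)// opprD addrACA.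
- by move=> c x Ex; rewrite (bopZ hF)// (bopZ hG)// scalerBr.
- by move=> x a Ex; rewrite (bopa hF)// (bopa hG)// ractDl ractNl.
- move=> x Ex; rewrite (le_trans (nmD (banach_l2 A) (EF _ Ex) (ENG _ Ex)))// mulrDl.
  by rewrite lerD ?hk// (nmN (banach_l2 A)) ?hl//; apply: EG.
Qed.

Lemma hn_ract x (a : A) : elts2 x -> hn (ract x a) <= hn x * nrm a.
Proof.
move=> Ex; have Exa : elts2 (ract x a) by apply: elts_ract.
rewrite -(@ler_pXn2r _ 2) ?nnegrE ?mulr_ge0 ?hn_ge0 ?nrm_ge0//.
rewrite exprMn !hn_sqr inner_ract// -(inner_star Ex Exa) inner_ract// starM (inner_star Ex Ex).
rewrite (le_trans (nrmM _ _))// mulrC expr2 mulrCA ler_wpM2l ?nrm_ge0//.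
by rewrite (le_trans (nrmM _ _))// nrm_star mulrC.
Qed.

Lemma bop_finite_rank n (g w : 'I_n -> l2 A) : (forall i, elts2 (g i)) ->
  (forall i, elts2 (w i)) ->
  bounded_operator (fun y => \sum_i ract (g i) (inner (w i) y)).
Proof.
move=> Eg Ew; have hf := inner_form A.
apply: (@bounded_operatorI _ (\sum_i 4 * hn (g i) * hn (w i))).
- by move=> x _; apply: (submodule_comb _ closed_elts.1).
- move=> x y Ex Ey; rewrite -big_split; apply: eq_bigr => i _.
  by rewrite (formDr hf)// ractDr.
- move=> k x Ex; rewrite scaler_sumr; apply: eq_bigr => i _.
  by rewrite (formZr hf)// ractZr.
- move=> x a Ex; rewrite ract_suml; apply: eq_bigr => i _.
  by rewrite inner_ract// ractM.
move=> x Ex; elim: (index_enum _) => [|i s IH].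
  by rewrite !big_nil (nm0 (banach_l2 A)) mul0r.
have Er j : elts2 (ract (g j) (inner (w j) x)) by apply: elts_ract.
rewrite !big_cons mulrDl (le_trans (nmD (banach_l2 A) (Er i) _))//.
  by apply: (form_sum_closed hf (banach0 (banach_l2 A))).
rewrite lerD// (le_trans (hn_ract _ (Eg i)))//.
have h : nrm (inner (w i) x) <= 4 * hn (w i) * hn x := form_cauchy hf (Ew i) Ex.
have := ler_wpM2l (hn_ge0 (g i)) h.
by move=> h'; apply: (le_trans h'); rewrite le_eqVlt; apply/orP; left; apply/eqP; ring.
Qed.

Lemma closed_Ker T : bounded_operator T -> closed_submodule (Ker T).
Proof.
move=> hT; have ET := bopE hT; split.
  split; first by move=> x [].
  - by split; [exact: banach0 (banach_l2 A)|exact: bop0].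
  - by move=> x y [Ex Tx] [Ey Ty]; split; [exact: eltsD|rewrite (bopD hT)// Tx Ty addr0].
  - by move=> c x [Ex Tx]; split; [exact: eltsZ|rewrite (bopZ hT)// Tx scaler0].
  - move=> x a [Ex Tx]; split; first exact: elts_ract.
    by rewrite (bopa hT)// Tx; apply/funext => i; apply: cmul0l.
apply/is_closedP => x Ex hx; split=> //.
have E0 : elts2 0 := banach0 (banach_l2 A).
apply: (eq_small (banach_l2 A)) => //; first exact: ET.
have [k k0 hk] := bop_bound hT.
move=> e e0; have k1 : 0 < k + 1 by rewrite ltr_wpDl.
have [y [Ey Ty] xy] := hx _ (divr_gt0 e0 k1).
have Exy : elts2 (x - y) by apply: (banachB (banach_l2 A)).
rewrite -Ty -(bopB hT)// (le_trans (hk _ Exy))//.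
rewrite (@le_trans _ _ ((k + 1) * hn (x - y)))//.
  by rewrite ler_wpM2r ?hn_ge0// lerDl.
by rewrite mulrC -ler_pdivlMr.
Qed.

End Operators.

(** * Generalized inverses *)

Section Assembly.
Context (R : realType) (A : cstarAlgType R).
Implicit Types (x y z : l2 A) (M N E : set (l2 A)) (F G S T : l2 A -> l2 A).

Local Notation elts2 := (@elts _ _ (l2 A)).
Local Notation hnA := (@hn _ A).

Lemma closed_of_seq (M : set (l2 A)) x : closed_submodule M -> elts2 x ->
  (forall e : R, 0 < e -> exists2 y, M y & hn (x - y) <= e) -> M x.
Proof. by move=> [_ /is_closedP h]; apply: h. Qed.

Lemma hn_dist2 x x' y y' (e : R) : elts2 x -> elts2 x' -> elts2 y -> elts2 y' ->
  hn (x - x') <= e -> hn (y - y') <= e -> hn ((x + y) - (x' + y')) <= e + e.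
Proof.
move=> Ex Ex' Ey Ey' h h'; rewrite opprD addrACA.
have hB := banach_l2 A.
by rewrite (le_trans (nmD hB (banachB hB Ex Ex') (banachB hB Ey Ey')))// lerD.
Qed.

Lemma decomposition_projection M N : direct_decomposition M N -> exists P,
  [/\ bounded_operator P, forall x, elts2 x -> M (P x) /\ N (x - P x),
      forall x, M x -> P x = x & forall x, N x -> P x = 0].
Proof.
move=> [clM clN MN0 MN]; have hB := banach_l2 A.
have [ME M0 MD MZ Ma] := clM.1; have [NE N0 ND NZ Na] := clN.1.
have MNeq x : M x -> N x -> x = 0.
  by move=> Mx Nx; have : (M `&` N) x by []; rewrite MN0.
have [||||||S [hS bS]] := @closed_relation_operator _ _ elts2 M (fun x m => N (x - m))
  (closed_elts A) clM.
- by move=> x y m n _ _ _ _ h h'; rewrite opprD addrACA; apply: ND.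
- by move=> k x m _ _ h; rewrite -scalerBr; apply: NZ.
- move=> x m Ex Mm h; apply: (closed_of_seq clN); first exact/(banachB hB)/ME.
  move=> e e0; have [y [n [Ey Mn Nyn h1 h2]]] := h _ (divr_gt0 e0 (ltr0Sn _ 1)).
  exists (y - n) => //; rewrite (splitr e); apply: hn_dist2 => //.
  + exact/(banachN hB)/ME.
  + exact/(banachN hB)/ME.
  + rewrite -opprD (nmN hB) ?opprK//; apply: (banachB hB); exact: ME.
- by move=> x Ex; have [m [n [Mm Nn ->]]] := MN _ Ex; exists m => //; rewrite addrC addKr.
- by move=> x m a _ _ h; rewrite -ractNl -ractDl; apply: Na.
- move=> x m n Ex Mm Mn h h'; apply/subr0_eq/MNeq; first exact: closed_submoduleB.
  have -> : m - n = (x - n) - (x - m) by lmodule R[i]; ring.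
  exact: closed_submoduleB.
have SE x : elts2 x -> M (S x) /\ N (x - S x) by apply: hS.
exists S; split=> //.
- by case: bS => h1 h2 h3 h4 h5; split=> // x /h1 /ME.
- move=> x Mx; have [MS NS] := SE _ (ME _ Mx); apply/esym/subr0_eq/MNeq => //.
  exact: closed_submoduleB.
- move=> x Nx; have [MS NS] := SE _ (NE _ Nx); apply: MNeq => //.
  by rewrite -[S x](subKr x); apply: closed_submoduleB.
Qed.

Lemma isomorphism_inverse M N F : closed_submodule M -> closed_submodule N ->
  is_isomorphism M N F -> exists S, bounded_Alinear N M S /\
    forall y, N y -> F (S y) = y.
Proof.
move=> clM clN [bF [Ffun Finj Fsurj]]; have hB := banach_l2 A.
have [ME M0 MD MZ Ma] := clM.1; have [NE N0 ND NZ Na] := clN.1.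
have [k k0 hk] := bounded_real bF; have [FN FD FZ Fa _] := bF.
have [||||||S [hS bS]] := @closed_relation_operator _ _ N M (fun y x => F x = y) clN clM.
- by move=> x y m n _ _ Mm Mn <- <-; apply: FD.
- by move=> c x m _ Mm <-; apply: FZ.
- move=> y m Ny Mm h; apply: (eq_small hB); [exact/NE/FN|exact: NE|].
  move=> e e0; have k1 : 0 < k + 1 by rewrite ltr_wpDl.
  have [y' [n [Ny' Mn Fn h1 h2]]] := h _ (divr_gt0 e0 k1).
  have [EFm EFn] : elts2 (F m) /\ elts2 (F n) by split; apply/NE/FN.
  rewrite (le_trans (nm_triangle hB EFm EFn (NE _ Ny)))// Fn.
  have Mmn := closed_submoduleB clM Mm Mn.
  have -> : F m - y' = F (m - n).
    have MNn : M (-1 *: n) by apply: MZ.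
    by rewrite -Fn -scaleN1r -FZ// -FD// scaleN1r.
  have := hk _ Mmn; have := ler_wpM2l k0 h2.
  have : (k + 1) * (e / (k + 1)) = e by rewrite mulrC divfK// gt_eqF.
  rewrite mulrDl mul1r; have : hn (y' - y) <= e / (k + 1).
    by rewrite (nm_distC hB)//; apply: NE.
  lra.
- by move=> y /Fsurj[x Mx Fx]; exists x.
- by move=> y m a _ Mm <-; apply: Fa.
- by move=> y m n _ Mm Mn <- /esym; apply: Finj; rewrite inE.
by exists S; split=> // y /hS[].
Qed.

(** [F S] is then a bounded projection onto [Im F], and [1 - S F] one onto [Ker F]. *)
Definition generalized_inverse F S : Prop :=
  [/\ bounded_operator F, bounded_operator S & forall x, elts2 x -> F (S (F x)) = F x].

Lemma Im_submodule F : bounded_operator F -> is_submodule (Im F).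
Proof.
move=> hF; have hB := banach_l2 A; split.
- by move=> _ [x Ex <-]; apply: (bopE hF).
- by exists 0; [exact: banach0 hB|exact: bop0].
- by move=> _ _ [x Ex <-] [y Ey <-]; exists (x + y); [exact: eltsD|rewrite (bopD hF)].
- by move=> c _ [x Ex <-]; exists (c *: x); [exact: eltsZ|rewrite (bopZ hF)].
- by move=> _ a [x Ex <-]; exists (ract x a); [exact: elts_ract|rewrite (bopa hF)].
Qed.

(** Finite generation is asked of [F(N1)] rather than of [N1] or [N2], which lets one construction
    serve both classes of operators. The [g i] lift the generators to [N1]. *)
Lemma MPhi_ginv F M1 N1 M2 N2 n (g : 'I_n -> l2 A) : bounded_operator F ->
  MPhi_decomposition F M1 N1 M2 N2 -> is_closed (Im F) -> (forall i, N1 (g i)) ->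
  (forall y, (F @` N1) y -> exists a : 'I_n -> A, y = \sum_i ract (F (g i)) (a i)) ->
  exists S, generalized_inverse F S.
Proof.
move=> hF [d1 d2 FM FN iso] clF Ng gen; have hB := banach_l2 A.
have [clM1 clN1 MN1 tot1] := d1; have [clM2 clN2 MN2 tot2] := d2.
have M1E := clM1.1; have N1E := clN1.1.
have [P [bP PMN PM PN]] := decomposition_projection d2.
have [T [bT FT]] := isomorphism_inverse clM1 clM2 iso.
have E1 x : M1 x -> elts2 x by case: clM1 => -[h _ _ _ _] _; apply: h.
have E2 x : M2 x -> elts2 x by case: clM2 => -[h _ _ _ _] _; apply: h.
have En x : N1 x -> elts2 x by case: clN1 => -[h _ _ _ _] _; apply: h.
(* A limit [y] of points of [F(N1)] lies in [Im F] and in [N2]. The [M1]-component of a preimage is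
   then mapped into both [M2] and [N2], hence to 0, and the [N1]-component alone has image [y]. *)
have clFN : closed_submodule (F @` N1).
  case: clN1 => -[_ N0 ND NZ Na] _; split.
    split.
    - by move=> _ [x Nx <-]; apply/(bopE hF)/En.
    - by exists 0 => //; apply: bop0.
    - move=> _ _ [x Nx <-] [y Ny <-]; exists (x + y); first exact: ND.
      by rewrite (bopD hF)//; apply: En.
    - by move=> c _ [x Nx <-]; exists (c *: x); [exact: NZ|rewrite (bopZ hF)//; apply: En].
    - by move=> _ a [x Nx <-]; exists (ract x a); [exact: Na|rewrite (bopa hF)//; apply: En].
  move=> y Ey hy.
  have [x Ex Fx] : Im F y.
    by apply: clF => // e /hy[_ [x Nx <-] h]; exists (F x) => //; exists x => //; apply: En.
  have N2y : N2 y.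
    by apply: clN2.2 => // e /hy[_ [z Nz <-] h]; exists (F z) => //; apply: FN; exists z.
  have [m [n' [Mm Nn xE]]] := tot1 _ Ex.
  have Fm0 : F m = 0.
    have : (M2 `&` N2) (F m).
      split; first by apply: FM; exists m.
      have -> : F m = y - F n' by rewrite -Fx xE (bopD hF) ?addrK//; [exact: E1|exact: En].
      by apply: closed_submoduleB => //; apply: FN; exists n'.
    by rewrite MN2.
  by exists n' => //; rewrite -Fx xE (bopD hF) ?Fm0 ?add0r//; [exact: E1|exact: En].
have [w [Ew hw]] := fg_frame clFN (fun i => ex_intro2 _ _ (g i) (Ng i) erefl) gen.
have Eg i : elts2 (g i) by apply: En.
(* The frame expansion with the generators [F (g i)] replaced by their lifts: a right inverse of [F]
   on [F(N1)]. *)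
pose fr y := \sum_i ract (g i) (inner (w i) y).
have bfr : bounded_operator fr by apply: bop_finite_rank.
have [k k0 hk] := bounded_real bT; have [kP kP0 hkP] := bop_bound bP.
have PM2 x : elts2 x -> M2 (P x) by move=> /PMN[].
have [TM TD TZ Ta _] := bT.
have bTP : bounded_operator (fun y => T (P y)).
  apply: (@bounded_operatorI _ _ _ (k * kP)).
  - by move=> x /PM2/TM/E1.
  - by move=> x y Ex Ey; rewrite (bopD bP)// TD//; apply: PM2.
  - by move=> c x Ex; rewrite (bopZ bP)// TZ//; apply: PM2.
  - by move=> x a Ex; rewrite (bopa bP)// Ta//; apply: PM2.
  - by move=> x Ex; rewrite (le_trans (hk _ (PM2 _ Ex)))// -mulrA ler_wpM2l// hkP.
exists (fun y => T (P y) + fr (y - P y)); split=> //.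
  by apply: bop_add bTP (bop_comp (bop_sub (bop_id A) bP) bfr).
move=> x Ex; have [m [n' [Mm Nn ->]]] := tot1 _ Ex.
have [Em En'] := conj (E1 _ Mm) (En _ Nn).
have [FMm FNn] : M2 (F m) /\ N2 (F n') by split; [apply: FM; exists m|apply: FN; exists n'].
have [EFm EFn] := conj (bopE hF Em) (bopE hF En').
rewrite !(bopD hF)//; last 2 first.
- exact/E1/TM/PM2/eltsD.
- by apply/(bopE bfr)/(banachB hB); [|apply: bopE bP _ _]; apply: eltsD.
rewrite (bopD bP)// (PM _ FMm) (PN _ FNn) addr0 FT//.
have -> : F m + F n' - F m = F n' by rewrite addrAC subrr add0r.
by congr (_ + _); rewrite /fr (bop_sum hF)// -hw//; exists n'.
Qed.

Lemma fg_generators M : closed_submodule M -> finitely_generated M ->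
  exists n (g : 'I_n -> l2 A), (forall i, M (g i)) /\
    forall x, M x -> exists a : 'I_n -> A, x = \sum_i ract (g i) (a i).
Proof.
move=> clM [n [g [Mg gen]]]; exists n, g; split=> // x /gen[c [a ->]].
exists (fun i => c i *: cunit + a i); apply: eq_bigr => i _.
by rewrite ractDr ractZr ract1.
Qed.

Lemma fg_image F N n (g : 'I_n -> l2 A) : bounded_operator F -> N `<=` elts2 ->
  (forall i, N (g i)) ->
  (forall x, N x -> exists a : 'I_n -> A, x = \sum_i ract (g i) (a i)) ->
  forall y, (F @` N) y -> exists a : 'I_n -> A, y = \sum_i ract (F (g i)) (a i).
Proof.
move=> hF NE Ng gen _ [x /gen[a ->] <-]; exists a; apply: (bop_sum hF) => i.
exact: NE.
Qed.

Lemma MPhi_l_ginv F : MPhi_l F -> is_closed (Im F) -> exists S, generalized_inverse F S.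
Proof.
move=> [hF [M1 [N1 [M2 [N2 [d fg]]]]]] clF; have [[_ clN1 _ _] _ _ _ _] := d.
have [n [g [Ng gen]]] := fg_generators clN1 fg.
apply: (MPhi_ginv hF d clF Ng); apply: fg_image Ng gen => //.
by case: clN1 => -[].
Qed.

Lemma MPhi_r_ginv F : MPhi_r F -> is_closed (Im F) -> complementable (Im F) ->
  exists S, generalized_inverse F S.
Proof.
move=> [hF [M1 [N1 [M2 [N2 [d fg]]]]]] clF [F0 dF].
have [d1 d2 FM FN iso] := d.
have [clM1 clN1 MN1 tot1] := d1; have [clM2 clN2 MN2 tot2] := d2.
have [N2E _ _ _ _] := clN2.1; have [N1E _ _ _ _] := clN1.1; have [M1E _ _ _ _] := clM1.1.
have [n [g [Ng gen]]] := fg_generators clN2 fg.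
have [P [bP PMN PM PN]] := decomposition_projection d2.
have [Q [bQ QFF QF QF0]] := decomposition_projection dF.
(* [T] maps l2(A) into [F(N1)], because [Q] lands in [Im F] and [1 - P] removes the [M2]-part. It
   fixes [F(N1)], so the images of generators of [N2] generate [F(N1)]. *)
pose T y := Q y - P (Q y).
have bT : bounded_operator T by apply: bop_sub bQ (bop_comp bQ bP).
have TF y : elts2 y -> (F @` N1) (T y).
  move=> Ey; rewrite /T; have [[x Ex <-] _] := QFF _ Ey.
  have [m [n' [Mm Nn ->]]] := tot1 _ Ex.
  have [Em En] := conj (M1E _ Mm) (N1E _ Nn).
  have [FMm FNn] : M2 (F m) /\ N2 (F n') by split; [apply: FM; exists m|apply: FN; exists n'].
  exists n' => //; rewrite (bopD hF)// (bopD bP); [|exact: bopE|exact: bopE].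
  by rewrite (PM _ FMm) (PN _ FNn) addr0 addrC addKr.
have /choice[h hh] : forall i, exists x, N1 x /\ F x = T (g i).
  by move=> i; have [x Nx Fx] := TF _ (N2E _ (Ng i)); exists x.
apply: (@MPhi_ginv _ _ _ _ _ _ h hF d clF) => [i|_ [x Nx <-]]; first exact: (hh i).1.
have [a ha] := fg_image bT N2E Ng gen (ex_intro2 _ _ (F x) (FN _ (ex_intro2 _ _ x Nx erefl)) erefl).
exists a; under eq_bigr => i _ do rewrite (hh i).2.
rewrite -ha /T; have Ex := N1E _ Nx.
rewrite (QF (F x)); last by exists x.
by rewrite PN ?subr0//; apply: FN; exists x.
Qed.

(** As [F] is injective on [M1], its kernel lies in [N1]; the projection [1 - S F] onto the kernel
    therefore carries generators of [N1] to generators of [Ker F]. *)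
Lemma MPhi_l_Ker_fg F S : MPhi_l F -> generalized_inverse F S ->
  exists n (k : 'I_n -> l2 A), (forall i, Ker F (k i)) /\
    forall x, Ker F x -> exists a : 'I_n -> A, x = \sum_i ract (k i) (a i).
Proof.
move=> [hF [M1 [N1 [M2 [N2 [d fg]]]]]] [_ bS FSF].
have [d1 d2 FM FN iso] := d.
have [clM1 clN1 MN1 tot1] := d1; have [clM2 clN2 MN2 tot2] := d2.
have [N2E _ _ _ _] := clN2.1; have [N1E _ _ _ _] := clN1.1; have [M1E M10 _ _ _] := clM1.1.
have [n [g [Ng gen]]] := fg_generators clN1 fg.
have hB := banach_l2 A.
pose T x := x - S (F x).
have bT : bounded_operator T by apply: bop_sub (bop_id A) (bop_comp hF bS).
have KT x : elts2 x -> Ker F (T x).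
  move=> Ex; split; first exact: bopE.
  rewrite /T (bopB hF)// ?FSF ?subrr//; exact/(bopE bS)/(bopE hF).
exists n, (fun i => T (g i)); split=> [i|x [Ex Fx]]; first exact/KT/N1E.
have Nx : N1 x.
  have [m [n' [Mm Nn xE]]] := tot1 _ Ex.
  have [Em En] := conj (M1E _ Mm) (N1E _ Nn).
  have [FMm FNn] : M2 (F m) /\ N2 (F n') by split; [apply: FM; exists m|apply: FN; exists n'].
  have Fm0 : F m = 0.
    have : (M2 `&` N2) (F m).
      split=> //; have -> : F m = F x - F n' by rewrite xE (bopD hF)// addrK.
      rewrite Fx sub0r -sub0r; apply: closed_submoduleB => //.
      by case: clN2.1.
    by rewrite MN2.
  suff -> : x = n' by [].
  rewrite xE; suff -> : m = 0 by rewrite add0r.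
  have [_ [_ inj _]] := iso; apply: inj; rewrite ?inE//.
  by rewrite Fm0 (bop0 hF).
have Tx : T x = x by rewrite /T Fx (bop0 bS) subr0.
rewrite -{1}Tx; apply: (fg_image bT N1E Ng gen); by exists x.
Qed.

(** An element [u] with [G u = G (F x)] differs from [F x] by an element of [Ker G], so its part
    [P u] outside [Im F] lies in [Z]. A bounded section of [P] from [Z] to [Ker G] corrects [u] into
    [Im F] without changing [G u], after which [SF] applies. *)
Lemma ginv_comp F G SF SG n (k : 'I_n -> l2 A) :
  generalized_inverse F SF -> generalized_inverse G SG ->
  (forall i, Ker G (k i)) ->
  (forall x, Ker G x -> exists a : 'I_n -> A, x = \sum_i ract (k i) (a i)) ->
  is_closed (Im (G \o F)) -> exists S, generalized_inverse (G \o F) S.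
Proof.
move=> [bF bSF FSF] [bG bSG GSG] Kk gen clGF; have hB := banach_l2 A.
have bGF : bounded_operator (G \o F) := bop_comp bF bG.
pose P x := x - F (SF x).
have bP : bounded_operator P by apply: bop_sub (bop_id A) (bop_comp bSF bF).
have PF x : elts2 x -> P (F x) = 0 by move=> Ex; rewrite /P FSF// subrr.
have PP x : elts2 x -> P (P x) = P x.
  move=> Ex; rewrite {2}/P (bopB bP)//; last exact/(bopE bF)/(bopE bSF).
  by rewrite PF ?subr0//; apply: bopE.
have KE x : Ker G x -> elts2 x by case.
pose Z : set (l2 A) := P @` Ker G.
(* This description as a set of fixed points of [P] with [G z] in [Im (G \o F)] is where closedness
   of that image enters: both conditions are closed. *)
have ZP z : Z z <-> [/\ elts2 z, P z = z & Im (G \o F) (G z)].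
  split=> [[x Kx <-]|[Ez Pz [x Ex GFx]]].
    have Ex := KE _ Kx; split; [exact: bopE|exact: PP|].
    exists (- SF x); first exact/(banachN hB)/(bopE bSF).
    have ESx := bopE bSF Ex; have EFSx := bopE bF ESx.
    rewrite /= -sub0r (bopB bF) ?(bop0 bF)//; last exact: banach0 hB.
    rewrite sub0r /P (bopB bG)// Kx.2 -[in LHS]sub0r (bopB bG) ?(bop0 bG)//.
    exact: banach0 hB.
  have EFx := bopE bF Ex; exists (z - F x).
    split; first exact: (banachB hB).
    by rewrite (bopB bG)// -GFx subrr.
  by rewrite (bopB bP)// PF// subr0.
have clZ : closed_submodule Z.
  have [_ I0 ID IZ Ia] := Im_submodule bGF; split.
    split.
    - by move=> _ [x /KE Ex <-]; apply: bopE.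
    - by exists 0; [split; [exact: banach0 hB|exact: bop0]|exact: bop0].
    - move=> _ _ [x Kx <-] [y Ky <-]; exists (x + y).
        by have [[_ _ KD _ _] _] := closed_Ker bG; apply: KD.
      by rewrite (bopD bP)//; apply: KE.
    - move=> c _ [x Kx <-]; exists (c *: x).
        by have [[_ _ _ KZ _] _] := closed_Ker bG; apply: KZ.
      by rewrite (bopZ bP)//; apply: KE.
    - move=> _ a [x Kx <-]; exists (ract x a).
        by have [[_ _ _ _ Ka] _] := closed_Ker bG; apply: Ka.
      by rewrite (bopa bP)//; apply: KE.
  apply/is_closedP => z Ez hz; apply/ZP; split=> //.
    have bD := bop_sub bP (bop_id A).
    have [_ /is_closedP clK] := closed_Ker bD.
    have [] : Ker (fun x => P x - x) z; last by move=> _ /subr0_eq.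
    apply: clK => // e /hz[y /ZP[Ey Py _] h]; exists y => //.
    by split=> //; rewrite Py subrr.
  move: clGF => /is_closedP; apply; first exact: bopE.
  have [l l0 hl] := bop_bound bG.
  move=> e e0; have l1 : 0 < l + 1 by rewrite ltr_wpDl.
  have [y /ZP[Ey _ Gy] h] := hz _ (divr_gt0 e0 l1); exists (G y) => //.
  have Ezy : elts2 (z - y) by apply: (banachB hB).
  rewrite -(bopB bG)// (le_trans (hl _ Ezy))//.
  rewrite (@le_trans _ _ ((l + 1) * hn (z - y)))//.
    by rewrite ler_wpM2r ?hn_ge0// lerDl.
  by rewrite mulrC -ler_pdivlMr.
have Ek i : elts2 (k i) by apply: KE.
have [w [Ew hw]] := fg_frame clZ (fun i => ex_intro2 _ _ (k i) (Kk i) erefl)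
  (fg_image bP KE Kk gen).
pose fr y := \sum_i ract (k i) (inner (w i) y).
have bfr : bounded_operator fr by apply: bop_finite_rank.
have Kfr y : Ker G (fr y) by apply: (submodule_comb _ (closed_Ker bG).1).
have Pfr z : Z z -> P (fr z) = z by move=> Zz; rewrite /fr (bop_sum bP)// -hw.
(* The subtracted vector lies in [Ker G] and, on values of [G \o F], has the same image under [P] as
   [SG y]. There [U y] is a preimage of [y] under [G] that is killed by [P], that is, it lies in
   [Im F]. *)
pose U y := SG y - fr (P (SG y)).
have bU : bounded_operator U by apply: bop_sub bSG (bop_comp (bop_comp bSG bP) bfr).
exists (fun y => SF (U y)); split=> //; first exact: bop_comp bU bSF.
move=> x Ex /=; have EFx := bopE bF Ex; have EGFx := bopE bG EFx.
set u := SG (G (F x)); have Eu : elts2 u by apply: (bopE bSG).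
have Gu : G u = G (F x) by rewrite /u GSG.
have Ke : Ker G (u - F x) by split; [exact: (banachB hB)|rewrite (bopB bG)// Gu subrr].
have Pu : Z (P u).
  by exists (u - F x) => //; rewrite (bopB bP)// PF// subr0.
set v := U (G (F x)).
have vE : v = u - fr (P u) by [].
have Efr := KE _ (Kfr (P u)).
have Ev : elts2 v by apply: (bopE bU).
have Pv : P v = 0 by rewrite vE (bopB bP)// Pfr// subrr.
have -> : F (SF v) = v by apply/esym/subr0_eq.
by rewrite vE (bopB bG)// (Kfr _).2 subr0.
Qed.

Lemma ginv_complementable F S : generalized_inverse F S -> complementable (Im F).
Proof.
move=> [bF bS FSF]; have hB := banach_l2 A.
have bFS := bop_comp bS bF; exists (Ker (fun y => F (S y))).
have ImE y : Im F y <-> Ker (fun y => y - F (S y)) y.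
  split=> [[x Ex <-]|[Ey /subr0_eq yE]].
    by split; [exact: bopE|rewrite FSF// subrr].
  by rewrite yE; exists (S y) => //; apply: bopE.
have clK := closed_Ker (bop_sub (bop_id A) bFS).
split; [|exact: (closed_Ker bFS)| |].
- split; first exact: (Im_submodule bF).
  by apply/is_closedP => x Ex hx; apply/ImE; apply: (closed_of_seq clK) => // e /hx[y /ImE]; exists y.
- apply/seteqP; split=> [y [[x Ex <-] [_]]|_ ->].
    by rewrite FSF.
  split; first by have [] := Im_submodule bF.
  by split; [exact: banach0 hB|exact: (bop0 bFS)].
- move=> y Ey; have ESy := bopE bS Ey; have EFSy := bopE bF ESy.
  exists (F (S y)), (y - F (S y)); split; last by rewrite addrC subrK.
    by exists (S y).
  split; first exact: (banachB hB).
  by rewrite (bopB bFS)// FSF// subrr.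
Qed.

End Assembly.

(** * Embeddings into direct sums *)

Section DirectSums.
Context (R : realType) (A : cstarAlgType R).
Implicit Types (x y z : l2 A) (M N K : set (l2 A)) (F G S T : l2 A -> l2 A).

Local Notation elts2 := (@elts _ _ (l2 A)).
Local Notation hnA := (@hn _ A).
Local Notation dl2 := (dsum (l2 A) (l2 A)).

Definition hnd (z : dl2) : R := Num.sqrt (nrm (inner z z)).

Lemma hnorm_dsum (z : dl2) : hnorm z = (hnd z)%:C.
Proof. exact: hnorm_sqrt. Qed.

Lemma hnd_ge (z : dl2) : elts z -> hn z.1 <= hnd z /\ hn z.2 <= hnd z.
Proof.
case: z => x y [/= Ex Ey]; have hf := inner_form A.
have px := form_pos hf Ex; have py := form_pos hf Ey.
rewrite -(@ler_pXn2r _ 2) ?nnegrE ?hn_ge0 ?sqrtr_ge0//.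
rewrite -[in X in _ /\ X](@ler_pXn2r _ 2) ?nnegrE ?hn_ge0 ?sqrtr_ge0//.
rewrite !hn_sqr sqr_sqrtr ?nrm_ge0//.
split; apply: pos_le_nrm => //; last by rewrite addrK.
by rewrite addrC addrA addNr add0r.
Qed.

Lemma hnd_le (z : dl2) : hnd z <= hn z.1 + hn z.2.
Proof.
rewrite -(@ler_pXn2r _ 2) ?nnegrE ?addr_ge0 ?hn_ge0 ?sqrtr_ge0//.
rewrite sqr_sqrtr ?nrm_ge0// (le_trans (nrmD _ _))//.
rewrite -[nrm (inner z.1 z.1)]hn_sqr -[nrm (inner z.2 z.2)]hn_sqr.
by rewrite sqrrD lerD2r lerDl mulrn_wge0// mulr_ge0// hn_ge0.
Qed.

(* A left inverse [(x, y) |-> g1 x + g2 y] makes the image of [M] under [(f1, f2)] closed. *)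
Lemma split_preceq M K1 K2 f1 f2 g1 g2 : closed_submodule M ->
  closed_submodule K1 -> closed_submodule K2 ->
  bounded_operator f1 -> bounded_operator f2 ->
  bounded_operator g1 -> bounded_operator g2 ->
  (forall x, M x -> K1 (f1 x)) -> (forall x, M x -> K2 (f2 x)) ->
  (forall x, M x -> g1 (f1 x) + g2 (f2 x) = x) ->
  preceq M (ext_sum K1 K2).
Proof.
move=> clM clK1 clK2 bf1 bf2 bg1 bg2 fK1 fK2 gf; have hB := banach_l2 A.
have [ME M0 MD MZ Ma] := clM.1.
pose f x : dl2 := (f1 x, f2 x); exists (f @` M).
have Ef1 x : M x -> elts2 (f1 x) by move=> /ME; apply: bopE.
have Ef2 x : M x -> elts2 (f2 x) by move=> /ME; apply: bopE.
have [k1 k10 hk1] := bop_bound bf1; have [k2 k20 hk2] := bop_bound bf2.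
have [c1 c10 hl1] := bop_bound bg1; have [c2 c20 hl2] := bop_bound bg2.
have fD x y : M x -> M y -> f (x + y) = f x + f y.
  by move=> /ME Ex /ME Ey; rewrite /f (bopD bf1)// (bopD bf2).
have fZ (c : R[i]) x : M x -> f (c *: x) = c *: f x.
  by move=> /ME Ex; rewrite /f (bopZ bf1)// (bopZ bf2).
have fa x (a : A) : M x -> f (ract x a) = ract (f x) a.
  by move=> /ME Ex; rewrite /f (bopa bf1)// (bopa bf2).
split.
- split.
    split.
    + by move=> _ [x Mx <-]; split; [exact: Ef1|exact: Ef2].
    + by exists 0 => //; rewrite /f (bop0 bf1) (bop0 bf2).
    + by move=> _ _ [x Mx <-] [y My <-]; exists (x + y); [exact: MD|exact: fD].
    + by move=> c _ [x Mx <-]; exists (c *: x); [exact: MZ|exact: fZ].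
    + by move=> _ a [x Mx <-]; exists (ract x a); [exact: Ma|exact: fa].
  move=> [z1 z2] [/= E1 E2] hz.
  have near (e : R) : 0 < e -> exists m,
      [/\ M m, hn (z1 - f1 m) <= e & hn (z2 - f2 m) <= e].
    move=> e0; have ec0 : 0 < e%:C by rewrite -[0]/(0%:C) ltcR.
    have [_ [m Mm <-]] := hz _ ec0; rewrite hnorm_dsum ltcR => /ltW h.
    have Ez : elts ((z1, z2) - f m : dl2).
      by split; apply: (banachB hB) => //; [exact: Ef1|exact: Ef2].
    by have [h1 h2] := hnd_ge Ez; exists m; split=> //; apply: le_trans h.
  pose x := g1 z1 + g2 z2.
  have Eg1 := bopE bg1 E1; have Eg2 := bopE bg2 E2.
  have Ex : elts2 x by apply: eltsD.
  have xm (e : R) m : M m -> hn (z1 - f1 m) <= e -> hn (z2 - f2 m) <= e ->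
      hn (x - m) <= (c1 + c2) * e.
    move=> Mm h1 h2; rewrite -{1}(gf _ Mm) /x opprD addrACA.
    have [Em1 Em2] := conj (Ef1 _ Mm) (Ef2 _ Mm).
    have [D1 D2] := conj (banachB hB E1 Em1) (banachB hB E2 Em2).
    rewrite -(bopB bg1)// -(bopB bg2)//.
    rewrite (le_trans (nmD hB (bopE bg1 D1) (bopE bg2 D2)))// mulrDl.
    by rewrite lerD// ?(le_trans (hl1 _ D1))// ?(le_trans (hl2 _ D2))// ler_wpM2l.
  have l0 : 0 < c1 + c2 + 1 by rewrite ltr_wpDl// addr_ge0.
  have Mx : M x.
    apply: (closed_of_seq clM Ex) => e e0.
    have [m [Mm h1 h2]] := near _ (divr_gt0 e0 l0); exists m => //.
    rewrite (le_trans (xm _ _ Mm h1 h2))// mulrCA ger_pMr//.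
    by rewrite ler_pdivrMr// mul1r lerDl.
  have fx (fi : l2 A -> l2 A) z ki : bounded_operator fi -> elts2 z -> 0 <= ki ->
      (forall x, elts2 x -> hn (fi x) <= ki * hn x) ->
      (forall e : R, 0 < e -> exists m, [/\ M m, hn (x - m) <= (c1 + c2) * e
         & hn (z - fi m) <= e]) -> fi x = z.
    move=> bfi Ezz ki0 hki h; apply/esym/(eq_small hB) => //; first exact: bopE.
    move=> e e0; have c0 : 0 < ki * (c1 + c2) + 1.
      by rewrite ltr_wpDl// mulr_ge0// addr_ge0.
    have [m [Mm h1 h2]] := h _ (divr_gt0 e0 c0).
    have [Em Efm] := conj (ME _ Mm) (bopE bfi (ME _ Mm)).
    rewrite (le_trans (nm_triangle hB Ezz Efm (bopE bfi Ex)))//.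
    rewrite -(bopB bfi)//; have Emx := banachB hB Em Ex.
    rewrite (nm_distC hB)// in h1.
    have h3 := hki _ Emx; have h4 := ler_wpM2l ki0 h1.
    have h5 : e = ki * ((c1 + c2) * (e / (ki * (c1 + c2) + 1))) + e / (ki * (c1 + c2) + 1).
      by field; rewrite gt_eqF.
    by rewrite [in X in _ <= X]h5 addrC lerD// (le_trans h3).
  exists x => //; congr pair.
    apply: fx bf1 E1 k10 hk1 _ => e e0; have [m [Mm h1 h2]] := near _ e0.
    by exists m; split=> //; apply: xm.
  apply: fx bf2 E2 k20 hk2 _ => e e0; have [m [Mm h1 h2]] := near _ e0.
  by exists m; split=> //; apply: xm.
- by move=> _ [x Mx <-]; split; [exact: fK1|exact: fK2].
exists f; split.
  split=> //.
  exists (k1 + k2)%:C => x Mx; rewrite hnorm_dsum hnormE -rmorphM lecR.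
  rewrite (le_trans (hnd_le _))// mulrDl lerD ?hk1 ?hk2//; exact: ME.
split; first by move=> x Mx; exists x.
  move=> x y; rewrite !inE => Mx My [e1 e2].
  by rewrite -(gf _ Mx) -(gf _ My) e1 e2.
by move=> _ [x Mx <-]; exists x.
Qed.

Lemma complement_preceq F G SG (F0 G0 H0 : set (l2 A)) : bounded_operator F ->
  generalized_inverse G SG ->
  direct_decomposition (Im F) F0 -> direct_decomposition (Im G) G0 ->
  direct_decomposition (Im (G \o F)) H0 -> preceq H0 (ext_sum F0 G0).
Proof.
move=> bF [bG bS GSG] dF dG dH; have hB := banach_l2 A.
have [_ clF0 _ _] := dF; have [_ clG0 _ _] := dG; have [_ clH0 _ _] := dH.
(* [PF], [PG] and [PH] project onto the images themselves; the projections onto the complements are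
   [1 - PF], [1 - PG] and [1 - PH]. *)
have [PF [bPF hPF PF1 PF0]] := decomposition_projection dF.
have [PG [bPG hPG PG1 PG0]] := decomposition_projection dG.
have [PH [bPH hPH PH1 PH0]] := decomposition_projection dH.
have [H0E _ _ _ _] := clH0.1.
have idB P : bounded_operator P -> bounded_operator (fun x => x - P x).
  exact: bop_sub (bop_id A).
have bQ := idB _ bPH.
have bSPG := bop_comp bPG bS.
apply: (@split_preceq _ _ _ (fun x => SG (PG x) - PF (SG (PG x))) (fun x => x - PG x)
  (fun y => G y - PH (G y)) (fun y => y - PH y)) => //.
- exact: (bop_comp bSPG (idB _ bPF)).
- exact: idB.
- exact: (bop_comp bG bQ).
- by move=> x /H0E Ex; apply: (hPF _ _).2; apply: (bopE bSPG).
- by move=> x /H0E Ex; apply: (hPG _ Ex).2.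
move=> x Hx; have Ex := H0E _ Hx.
have [[z Ez Gz] _] := hPG _ Ex.
set u := SG (PG x); have Eu : elts2 u by apply: (bopE bSPG).
have Gu : G u = PG x by rewrite /u -Gz GSG.
have EPu := bopE bPF Eu; have EPG := bopE bPG Ex.
(* Replacing [u] by [u - PF u] changes [G u] only by this element of [Im (G \o F)], which [1 - PH]
   kills; so the left inverse sees [PG x + (x - PG x) = x], fixed by [1 - PH]. *)
have IPu : Im (G \o F) (G (PF u)).
  by have [[w Ew <-] _] := hPF _ Eu; exists w.
rewrite (bopB bG)// Gu.
have EGP : elts2 (G (PF u)) by apply: (bopE bG).
have EPH := bopE bPH EPG.
rewrite !(bopB bPH)// (PH1 _ IPu) (PH0 _ Hx).
by lmodule R[i]; ring.
Qed.

Lemma kernel_preceq F S G : generalized_inverse F S -> bounded_operator G ->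
  preceq (Ker (G \o F)) (ext_sum (Ker G) (Ker F)).
Proof.
move=> [bF bS FSF] bG.
have bSF := bop_comp bF bS.
apply: (@split_preceq _ _ _ F (fun x => x - S (F x)) S (fun x => x)) => //.
- exact: closed_Ker (bop_comp bF bG).
- exact: closed_Ker.
- exact: closed_Ker.
- exact: bop_sub (bop_id A) bSF.
- exact: bop_id.
- by move=> x [Ex GFx]; split=> //; apply: bopE.
- move=> x [Ex _]; have ESF := bopE bSF Ex; split; first exact: (banachB (banach_l2 A)).
  by rewrite (bopB bF)// FSF// subrr.
- by move=> x _; rewrite addrC subrK.
Qed.

End DirectSums.

Theorem proposition3p19 (R : realType) (A : cstarAlgType R) (hA : is_wstar A) :
  (forall F G : l2 A -> l2 A,
     MPhi_l F -> MPhi_l G ->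
     is_closed (Im F) -> is_closed (Im G) -> is_closed (Im (G \o F)) ->
     [/\ complementable (Im F), complementable (Im G),
         complementable (Im (G \o F)),
         (forall ImF0 ImG0 ImGF0 : set (l2 A),
            direct_decomposition (Im F) ImF0 ->
            direct_decomposition (Im G) ImG0 ->
            direct_decomposition (Im (G \o F)) ImGF0 ->
            preceq ImGF0 (ext_sum ImF0 ImG0))
       & preceq (Ker (G \o F)) (ext_sum (Ker G) (Ker F))])
  /\
  (forall F G : l2 A -> l2 A,
     MPhi_r F -> MPhi_r G ->
     is_closed (Im F) -> is_closed (Im G) -> is_closed (Im (G \o F)) ->
     complementable (Im F) -> complementable (Im G) ->
     complementable (Im (G \o F)) ->
     (forall ImF0 ImG0 ImGF0 : set (l2 A),
        direct_decomposition (Im F) ImF0 ->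
        direct_decomposition (Im G) ImG0 ->
        direct_decomposition (Im (G \o F)) ImGF0 ->
        preceq ImGF0 (ext_sum ImF0 ImG0))
     /\ preceq (Ker (G \o F)) (ext_sum (Ker G) (Ker F))).
Proof.
split=> F G hF hG clF clG clGF.
  have [SF gF] := MPhi_l_ginv hF clF; have [SG gG] := MPhi_l_ginv hG clG.
  have [n [k [Kk gen]]] := MPhi_l_Ker_fg hG gG.
  have [S gGF] := ginv_comp gF gG Kk gen clGF.
  split; [exact: ginv_complementable gF|exact: ginv_complementable gG
    |exact: ginv_complementable gGF| |].
    by move=> F0 G0 H0; apply: complement_preceq gG; case: gF.
  by apply: kernel_preceq gF _; case: gG.
move=> cF cG cGF.
have [SF gF] := MPhi_r_ginv hF clF cF; have [SG gG] := MPhi_r_ginv hG clG cG.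
split; last by apply: kernel_preceq gF _; case: gG.
by move=> F0 G0 H0; apply: complement_preceq gG; case: gF.
Qed.
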